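(* For all $\varepsilon,\alpha\in(0,1]$ there is $c_0>0$ such that for every $0<c\leq c_0$ there is $n_0$ such that the following holds for all $n\geq n_0$. Let $D$ be an $n$-vertex digraph with $\delta^0(D)\geq(1/2+\alpha)n$ and let $v\in V(D)$. Let $T$ be an oriented tree with at most $(1-\varepsilon)n$ vertices and $\Delta^\pm(T)\leq cn/\log n$, and let $t\in V(T)$. Then $D$ contains a copy of $T$ in which $t$ is copied to $v$.
   Context: Digraphs have edges that are ordered pairs of distinct vertices; $\delta^0(D)$ is the minimum over all vertices of the minimum of the in-degree and out-degree. An oriented tree is a tree with each edge given a direction; $\Delta^\pm(T)$ is the maximum degree of its underlying undirected tree. A copy of $T$ in $D$ is an injective map $V(T)\to V(D)$ mapping each directed edge of $T$ to an edge of $D$ with the same direction; ''$t$ is copied to $v$'' means $t$ is mapped to $v$. *)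

(* Defs.v *)
(* A digraph is a finType of vertices together
   with its arc relation; arcs are ordered pairs of distinct vertices, so both
   (x, y) and (y, x) may be present. *)
From mathcomp Require Import all_boot.

Set Implicit Arguments.
Unset Strict Implicit.
Unset Printing Implicit Defensive.

Definition is_digraph (V : finType) (d : rel V) : Prop := irreflexive d.

Definition outdeg (V : finType) (d : rel V) (x : V) : nat :=
  #|[set y | d x y]|.

Definition indeg (V : finType) (d : rel V) (x : V) : nat :=
  #|[set y | d y x]|.

(* All degrees are at most #|V|, so the initial value #|V| does not affect the
   minimum when V is inhabited. *)
Definition min_semideg (V : finType) (d : rel V) : nat :=
  \big[minn/#|V|]_(x : V) minn (indeg d x) (outdeg d x).

Definition underlying (V : finType) (d : rel V) : rel V :=
  fun x y => d x y || d y x.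

Definition connected_graph (V : finType) (e : rel V) : Prop :=
  0 < #|V| /\ forall x y : V, connect e x y.

(* In a symmetric relation, an edge traversed back and forth is a [ucycle] of
   size 2, which is not a graph cycle; hence the bound 3. *)
Definition acyclic_graph (V : finType) (e : rel V) : Prop :=
  forall s : seq V, 2 < size s -> ~ ucycle e s.

Definition is_tree (V : finType) (e : rel V) : Prop :=
  [/\ irreflexive e, symmetric e, connected_graph e & acyclic_graph e].

(* [antisymmetric] says that each edge of the tree gets only one direction. *)
Definition is_oriented_tree (V : finType) (d : rel V) : Prop :=
  [/\ is_digraph d, antisymmetric d & is_tree (underlying d)].

Definition max_underlying_deg (V : finType) (d : rel V) : nat :=
  \max_(x : V) #|[set y | underlying d x y]|.

Definition is_copy (T V : finType) (r : rel T) (d : rel V) (f : T -> V) : Prop :=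
  injective f /\ forall x y : T, r x y -> d (f x) (f y).

(* Main.v *)
(** The tree is embedded piece by piece, so that the set U of unused vertices
    always looks like a random subset: every in- and out-neighbourhood keeps
    density at least 1/2 + alpha/2 in U.

    Cut the tree, rooted at t, into pieces of bounded depth and of size at most
    s ~ n / log n, whose roots are a small proportion of all vertices: cut at
    one residue class of the depth, and below the O(log n) vertices carrying too
    many descendants (this is where the bound on the degree is used).  By the
    degree condition D[U] contains many arc-disjoint permutations, so a random
    walk on it can preserve the uniform distribution along any pattern of arc
    directions.  The root of a piece must lie in a prescribed neighbourhood M,
    but it can be placed at random in M, and its children at random around it,
    so that in- and out-children are both almost uniform on U.  Hence a random
    copy of the piece uses up all neighbourhoods in proportion to their size, up
    to the few piece roots; as s ~ n / log n, the deviations are controlled for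
    all 2n neighbourhoods at once by an exponential potential, and the random
    choice is replaced by the method of conditional expectations. *)
Require Import Defs.
From HB Require Import structures.
From mathcomp Require Import all_boot all_order all_algebra fingroup perm.
From mathcomp Require Import reals sequences exp.
From mathcomp Require Import zify ring lra.

Set Implicit Arguments.
Unset Strict Implicit.
Unset Printing Implicit Defensive.

Import Order.TTheory GRing.Theory Num.Theory.
Local Open Scope ring_scope.

(** * Arc-disjoint permutations *)

Definition arc (V : finType) (d : rel V) (b : bool) : rel V :=
  fun x y => if b then d x y else d y x.

Definition nb (V : finType) (d : rel V) (b : bool) (x : V) : {set V} :=
  [set y | arc d b x y].

Lemma in_nb (V : finType) (d : rel V) b x y : (y \in nb d b x) = arc d b x y.
Proof. by rewrite inE. Qed.

Lemma arcN (V : finType) (d : rel V) b x y : arc d (~~ b) x y = arc d b y x.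
Proof. by case: b. Qed.

Lemma card_capI_ge (X : finType) (U A B : {set X}) :
  (#|A :&: U| + #|B :&: U| <= #|U| + #|A :&: B :&: U|)%N.
Proof.
rewrite -cardsUI -setIIl -setIUl leq_add2r.
exact/subset_leq_card/subsetIr.
Qed.

(* A permutation maximising the number of x with e x (s x) is good everywhere:
   a bad x can be repaired by a swap that makes one more value good. *)
Lemma perm_on_rel (X : finType) (U : {set X}) (e : rel X) :
  (forall b x, x \in U -> #|U| <= 2 * #|nb e b x :&: U|)%N ->
  exists2 s : {perm X}, perm_on U s & forall x, x \in U -> e x (s x).
Proof.
move=> deg.
pose good (s : {perm X}) := [set x in U | e x (s x)].
have on1 : perm_on U (1%g : {perm X}) by apply: perm_on1.
pose s := [arg max_(s > (1%g : {perm X}) | perm_on U s) #|good s|]%N.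
have [sU smax] : perm_on U s /\
    forall s' : {perm X}, perm_on U s' -> (#|good s'| <= #|good s|)%N.
  by rewrite /s; case: arg_maxnP.
exists s => // x xU; apply/negPn/negP => nex.
(* Composing [s] with the transposition of [x] and [a] exchanges the values [s x] and [s a], so an
   [a] in both sets repairs [x] and is itself good. As [s] permutes [U], each set fills at least
   half of [U]; neither contains [x], so they meet in [U :\ x]. *)
pose A := [set a | e x (s a)]; pose B := nb e false (s x).
have sUE y : (s y \in U) = (y \in U) by apply: perm_closed.
have cA : #|A :&: U| = #|nb e true x :&: U|.
  rewrite -(card_imset _ (@perm_inj _ s)); apply: eq_card => y.
  apply/imsetP/idP => [[a]|]; first by rewrite !(inE, in_nb) => /andP[h aU] ->; rewrite /arc h sUE.
  rewrite !(inE, in_nb) /arc => /andP[h yU]; exists ((s^-1)%g y); last by rewrite permKV.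
  by rewrite !(inE, in_nb) permKV h -sUE permKV.
have hx : x \notin A :|: B by rewrite !(inE, in_nb) /arc (negbTE nex).
have /card_gt0P [a] : (0 < #|A :&: B :&: (U :\ x)|)%N.
  have := card_capI_ge (U :\ x) A B.
  have eqx (C : {set X}) : C \subset A :|: B -> C :&: (U :\ x) = C :&: U.
    move=> /subsetP sC; apply/setP => y; rewrite !(inE, in_nb); case: eqP => [->|] //=.
    by rewrite andbF; case hC: (x \in C) => //; move: hx; rewrite (sC _ hC).
  rewrite (eqx A) ?subsetUl // (eqx B) ?subsetUr // cA.
  have := deg true _ xU; have := deg false (s x); rewrite sUE => /(_ xU).
  rewrite -/B (cardsD1 x U) xU.
  lia.
rewrite !(inE, in_nb) => /and3P[/andP[h1 h2] ax aU].
pose s' := (tperm x a * s)%g.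
have s'U : perm_on U s'.
  apply: perm_onM sU; apply/subsetP => y; rewrite inE.
  by case: tpermP => [->|->|]; rewrite ?xU ?aU ?eqxx.
have := smax _ s'U; apply/negP; rewrite -ltnNge.
apply: (@leq_trans #|x |: good s|).
  by rewrite cardsU1 inE xU (negbTE nex).
apply: subset_leq_card; apply/subsetP => y; rewrite !(inE, in_nb) /s' permM.
case/orP => [/eqP->|/andP[yU ey]]; first by rewrite tpermL xU.
rewrite yU /=; case: tpermP => // eya; last by rewrite eya.
by move: ey; rewrite eya (negbTE nex).
Qed.

(** Permutations are peeled off one at a time. Removing a [k]-regular [g] lowers each degree by at
    most [k], and the slack in the hypothesis keeps it at half of [U], so [perm_on_rel] applies
    again. *)
Lemma regular_subrel (X : finType) (U : {set X}) (e : rel X) (k : nat) :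
  (forall b x, x \in U -> #|U| + 2 * k <= 2 * #|nb e b x :&: U|)%N ->
  exists2 g : rel X, forall x y, g x y -> [/\ x \in U, y \in U & e x y] &
    forall b x, x \in U -> #|nb g b x| = k.
Proof.
elim: k => [|k IH] deg.
  exists (fun _ _ => false) => // b x _; apply: eq_card0 => y.
  by rewrite in_nb /arc if_same.
have [|g gsub gk] := IH.
  by move=> b x xU; have := deg b x xU; lia.
have [|s sU es] := @perm_on_rel _ U (fun x y => e x y && ~~ g x y).
  move=> b x xU; have := deg b x xU; have := gk b x xU.
  have -> : nb (fun x y => e x y && ~~ g x y) b x :&: U
            = (nb e b x :&: U) :\: nb g b x.
    by apply/setP => y; rewrite !(inE, in_nb) /arc; case: b; case: (y \in U); rewrite ?andbF ?andbT // andbC.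
  rewrite cardsD => gc.
  have : (#|nb e b x :&: U :&: nb g b x| <= #|nb g b x|)%N.
    exact/subset_leq_card/subsetIr.
  lia.
exists (fun x y => g x y || (x \in U) && (s x == y)).
  move=> x y /orP[/gsub//|/andP[xU /eqP<-]].
  by rewrite (perm_closed _ sU) xU; have /andP[] := es x xU.
have sUE y : (s y \in U) = (y \in U) by apply: perm_closed.
move=> b x xU.
pose z := if b then s x else ((s^-1)%g x).
have -> : nb (fun x y => g x y || (x \in U) && (s x == y)) b x = z |: nb g b x.
  apply/setP => y; rewrite !(inE, in_nb) /arc /z; case: b {z}.
    by rewrite xU /= orbC eq_sym.
  rewrite orbC; congr (_ || _).
  apply/andP/eqP => [[_ /eqP<-]|->]; first by rewrite permK.
  by rewrite permKV -sUE permKV.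
rewrite cardsU1 gk // /z in_nb /arc; case: b {z}.
  by have /andP[_ ->] := es x xU.
have xU' : (s^-1)%g x \in U by rewrite -sUE permKV.
by have /andP[_] := es _ xU'; rewrite permKV => ->.
Qed.

(** * Transition kernels *)

(** The pointwise bound [B] limits the mass of a row on occupied vertices: at most [B * s] on [s] of
    them. *)
Definition arc_kernel (R : realFieldType) (V : finType) (d : rel V)
    (U X : {set V}) (B : R) (Q : bool -> V -> V -> R) : Prop :=
  [/\ forall b x y, 0 <= Q b x y <= B,
      forall b x y, Q b x y != 0 -> arc d b x y && (y \in U) &
      forall b x, x \in X -> \sum_y Q b x y = 1].

Lemma sumr_mem (R : nzSemiRingType) (V : finType) (A : {set V}) :
  \sum_y ((y \in A)%:R : R) = #|A|%:R.
Proof.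
rewrite -sum1_card natr_sum [in RHS]big_mkcond /=.
by apply: eq_bigr => y _; case: (y \in A).
Qed.

(** A uniform step along a [k]-regular relation is doubly stochastic on [U] for both signs, so it
    preserves the uniform distribution whatever the directions of the tree edges. *)
Lemma walk_kernel (R : realFieldType) (V : finType) (d : rel V)
    (U : {set V}) (k : nat) :
  (0 < k)%N ->
  (forall b x, x \in U -> #|U| + 2 * k <= 2 * #|nb d b x :&: U|)%N ->
  exists2 P : bool -> V -> V -> R, arc_kernel d U U k%:R^-1 P &
    forall b y, \sum_(x in U) P b x y <= 1.
Proof.
move=> k0 /regular_subrel[g gsub gk].
have kn0 : (k%:R : R) != 0 by rewrite pnatr_eq0 -lt0n.
have ki : 0 <= (k%:R : R)^-1 by rewrite invr_ge0 ler0n.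
have rowE b x : x \in U -> \sum_y (y \in nb g b x)%:R / k%:R = 1 :> R.
  by move=> xU; rewrite -mulr_suml sumr_mem gk // divff.
have supp b x y : y \in nb g b x -> [/\ x \in U, y \in U & arc d b x y].
  by rewrite in_nb /arc; case: b => /gsub[].
exists (fun b x y => (y \in nb g b x)%:R / k%:R); first split.
- move=> b x y; case: (y \in nb g b x); last by rewrite mul0r lexx.
  by rewrite mul1r lexx ki.
- move=> b x y; case h : (y \in nb g b x); last by rewrite mul0r eqxx.
  by have [_ -> ->] := supp _ _ _ h.
- exact: rowE.
move=> b y; rewrite big_mkcond /=; case yU : (y \in U).
  rewrite [leRHS](esym (rowE (~~ b) y yU)); apply: ler_sum => x _.
  rewrite !in_nb arcN; case: (x \in U) => //=.
  by rewrite divr_ge0 // ler0n.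
rewrite big1 ?ler01 // => x _; case: ifP => // _.
case h : (y \in nb g b x); last by rewrite mul0r.
by have [_] := supp _ _ _ h; rewrite yU.
Qed.

Definition unif (R : realFieldType) (V : finType) (A : {set V}) (y : V) : R :=
  (y \in A)%:R / #|A|%:R.

Lemma unif_ge0 (R : realFieldType) (V : finType) (A : {set V}) y :
  0 <= unif R A y.
Proof. by rewrite mulr_ge0 ?invr_ge0 ?ler0n. Qed.

Lemma unif_le (R : realFieldType) (V : finType) (A : {set V}) (a : R) y :
  0 < a -> a <= #|A|%:R -> unif R A y <= a^-1.
Proof.
move=> a0 aA; rewrite /unif; apply: (@le_trans _ _ (#|A|%:R^-1)).
  by rewrite ler_piMl ?invr_ge0 ?ler0n // lern1 leq_b1.
by rewrite lef_pV2 // posrE // (lt_le_trans a0).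
Qed.

Lemma unif_neq0 (R : realFieldType) (V : finType) (A : {set V}) y :
  unif R A y != 0 -> y \in A.
Proof. by rewrite /unif; case: (y \in A) => //; rewrite mul0r eqxx. Qed.

Lemma sum_unif (R : realFieldType) (V : finType) (A : {set V}) :
  0 < (#|A|%:R : R) -> \sum_y unif R A y = 1.
Proof. by move=> A0; rewrite -mulr_suml sumr_mem divff // gt_eqF. Qed.

(* Weights for L+1 placements of a vertex c in M, together with, for each sign
   b, a redistribution J b of the same weights from c to its b-neighbours.
   The last placement mu sends its weight on the open sign s evenly to the
   neighbours; the next placement repairs this by aiming its s-part at the
   complementary density 2/N - nu, and in turn opens the opposite sign. *)
Lemma restart_chain (R : realFieldType) (V : finType) (d : rel V)
    (U M : {set V}) (g : R) (L : nat) :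
  let N : R := #|U|%:R in
  0 < g -> g <= 2^-1 -> 0 < N -> M \subset U ->
  (forall b x, (2^-1 + g) * N <= #|nb d b x :&: U|%:R) ->
  (2^-1 + g) * N <= #|M|%:R ->
  exists (m mu : V -> R) (J : bool -> V -> V -> R) (s : bool),
  [/\ [/\ forall c, 0 <= mu c <= (g * N)^-1,
          forall c, mu c != 0 -> c \in M &
          \sum_c mu c = 1],
      [/\ forall c, c \in M -> N^-1 <= m c,
          forall c, m c != 0 -> c \in M &
          \sum_c m c = L.+1%:R],
      [/\ forall b c y, 0 <= J b c y <= L.+1%:R * (2 / (g * N ^+ 2)),
          forall b c y, J b c y != 0 -> arc d b c y && (y \in U) &
          forall b c, \sum_y J b c y = m c] &
      (forall y, \sum_c J s c y <=
         L.+1%:R / N + \sum_c mu c * unif R (nb d s c :&: U) y) /\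
      (forall y, \sum_c J (~~ s) c y <= L.+2%:R / N)].
Proof.
move=> N g0 g2 N0 MU deg Mb.
have hN : 0 < 2^-1 * N by rewrite mulr_gt0 // invr_gt0.
have gN : 0 < g * N by rewrite mulr_gt0.
have degh b x : 2^-1 * N <= #|nb d b x :&: U|%:R.
  apply: le_trans (deg b x); rewrite ler_pM2r // lerDl; exact: ltW.
have Mh : 2^-1 * N <= #|M|%:R.
  apply: le_trans Mb; rewrite ler_pM2r // lerDl; exact: ltW.
have MN : (#|M|%:R : R) <= N by rewrite ler_nat subset_leq_card.
have two : (2^-1 * N)^-1 = 2 / N :> R by rewrite invfM invrK.
have spreadU b c y : unif R (nb d b c :&: U) y <= 2 / N.
  by rewrite -two; apply: unif_le.
have sum_spread b c : \sum_y unif R (nb d b c :&: U) y = 1.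
  by apply: sum_unif; apply: lt_le_trans (degh b c).
have spread_supp b c y : unif R (nb d b c :&: U) y != 0 ->
    arc d b c y && (y \in U).
  by move=> /unif_neq0; rewrite inE in_nb.
(* Both sets exceed half of [U] by [g * N], so every [y] can be reached from at least [2 * g * N]
   vertices of [M]. *)
have gap b y : 2 * g * N <= #|nb d b y :&: M|%:R.
  have := card_capI_ge U (nb d b y) M.
  rewrite -setIA (setIidPl MU) -(ler_nat R) !natrD.
  have := deg b y; rewrite -/N; move: Mb; lra.
have gg : 0 < 2 * g * N by rewrite mulr_gt0 // mulr_gt0.
have back_le b y c : unif R (nb d b y :&: M) c <= (2 * g * N)^-1.
  by apply: unif_le.
have sum_back b y : \sum_c unif R (nb d b y :&: M) c = 1.
  by apply: sum_unif; apply: lt_le_trans (gap b y).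
have back_supp b y c : unif R (nb d (~~ b) y :&: M) c != 0 ->
    (c \in M) && arc d b c y.
  by move=> /unif_neq0; rewrite inE in_nb arcN andbC.
have nu_ge0 (mu : V -> R) b y : (forall c, 0 <= mu c <= (g * N)^-1) ->
    0 <= \sum_c mu c * unif R (nb d b c :&: U) y.
  move=> mu0; apply: sumr_ge0 => c _; rewrite mulr_ge0 ?unif_ge0 //.
  by case/andP: (mu0 c).
have nu_le (mu : V -> R) b y : (forall c, 0 <= mu c <= (g * N)^-1) ->
    \sum_c mu c = 1 -> \sum_c mu c * unif R (nb d b c :&: U) y <= 2 / N.
  move=> mu0 mu1; have -> : 2 / N = \sum_c mu c * (2 / N).
    by rewrite -mulr_suml mu1 mul1r.
  apply: ler_sum => c _.
  by rewrite ler_wpM2l ?spreadU //; case/andP: (mu0 c).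
have sum_nu (mu : V -> R) b : \sum_c mu c = 1 ->
    \sum_y \sum_c mu c * unif R (nb d b c :&: U) y = 1.
  move=> mu1; rewrite exchange_big /= -[RHS]mu1; apply: eq_bigr => c _.
  by rewrite -mulr_sumr sum_spread mulr1.
have row_spread (mu : V -> R) b c :
    \sum_y mu c * unif R (nb d b c :&: U) y = mu c.
  by rewrite -mulr_sumr sum_spread mulr1.
have spread_bd (mu : V -> R) b c y : 0 <= mu c <= (g * N)^-1 ->
    0 <= mu c * unif R (nb d b c :&: U) y <= 2 / (g * N ^+ 2).
  move=> /andP[mu0 mu1]; rewrite mulr_ge0 ?unif_ge0 //=.
  have -> : 2 / (g * N ^+ 2) = (g * N)^-1 * (2 / N).
    by field; rewrite !gt_eqF.
  by rewrite ler_pM ?unif_ge0 ?spreadU.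
elim: L => [|L [m [mu [J [s [[mu0 muM mu1] [m0 mM m1] [J0 Jsupp Jrow] [Js Jns]]]]]]].
  have mu0 c : 0 <= unif R M c <= (g * N)^-1.
    rewrite unif_ge0 unif_le // (le_trans _ Mh) //.
    by rewrite ler_pM2r.
  have mu1 : \sum_c unif R M c = 1 by apply: sum_unif; apply: lt_le_trans Mh.
  (* The first placement is uniform on [M] and spread evenly for both signs; it already gives
     [N^-1 <= m c] on [M]. *)
  exists (unif R M), (unif R M),
    (fun b c y => unif R M c * unif R (nb d b c :&: U) y), true; split.
  - by split=> // c /unif_neq0.
  - split=> // [c cM|c /unif_neq0//]; rewrite /unif cM mul1r lef_pV2 ?posrE //.
    exact: lt_le_trans Mh.
  - split=> [b c y|b c y|b c]; first by rewrite mul1r spread_bd.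
      by rewrite mulf_eq0 negb_or => /andP[_ /spread_supp].
    exact: row_spread.
  - split=> y; first by rewrite lerDr divr_ge0 // ltW.
    exact: nu_le.
pose nu y := \sum_c mu c * unif R (nb d s c :&: U) y.
(* Every neighbourhood has at least [N / 2] vertices in [U], so [nu <= 2 / N] and [la] is a
   probability density. *)
pose la y := (y \in U)%:R * (2 / N - nu y).
have la0 y : 0 <= la y by rewrite mulr_ge0 // subr_ge0 nu_le.
have nu0 y : y \notin U -> nu y = 0.
  move=> yU; rewrite /nu big1 // => c _; apply/eqP; rewrite mulf_eq0.
  by apply/orP; right; apply: contraNT yU => /spread_supp/andP[].
have laE y : la y = (y \in U)%:R * (2 / N) - nu y.
  rewrite /la mulrBr; congr (_ - _); case yU: (y \in U); first by rewrite mul1r.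
  by rewrite nu0 ?yU ?mul0r.
have la_le y : la y <= 2 / N.
  rewrite laE; apply: (@le_trans _ _ ((y \in U)%:R * (2 / N))).
    by rewrite gerBl nu_ge0.
  by rewrite ler_piMl ?lern1 ?leq_b1 // divr_ge0 // ltW.
have la1 : \sum_y la y = 1.
  under eq_bigr do rewrite laE.
  rewrite sumrB sum_nu // -mulr_suml sumr_mem -/N; field; exact: lt0r_neq0.
(* The pair is drawn backwards: [y] from [la], then [c] uniformly among the vertices of [M] with an
   [s]-arc to [y]. *)
pose Jt c y := la y * unif R (nb d (~~ s) y :&: M) c.
pose mu' c := \sum_y Jt c y.
have Jt0 c y : 0 <= Jt c y by rewrite mulr_ge0 ?unif_ge0.
have Jt_le c y : Jt c y <= 2 / (g * N ^+ 2).
  apply: (@le_trans _ _ (2 / N * (2 * g * N)^-1)).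
    by rewrite ler_pM ?unif_ge0.
  have -> : 2 / N / (2 * g * N) = 2^-1 * (2 / (g * N ^+ 2)).
    by field; rewrite !gt_eqF.
  rewrite ler_piMl // ?invf_le1 ?ler1n //.
  by rewrite divr_ge0 // ltW // mulr_gt0 // exprn_gt0.
have mu'M c : mu' c != 0 -> c \in M.
  apply: contraR => cM; rewrite /mu' big1 // => y _; apply/eqP.
  rewrite mulf_eq0; apply/orP; right.
  by apply: contraNT cM => /back_supp/andP[].
have mu'0 c : 0 <= mu' c <= (g * N)^-1.
  rewrite sumr_ge0 //=.
  apply: (@le_trans _ _ (\sum_y la y * (2 * g * N)^-1)).
    by apply: ler_sum => y _; rewrite ler_wpM2l.
  rewrite -mulr_suml la1 mul1r lef_pV2 ?posrE // -mulrA ler_peMl ?ler1n //.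
  exact: ltW.
have mu'1 : \sum_c mu' c = 1.
  rewrite /mu' exchange_big /= -[RHS]la1; apply: eq_bigr => y _.
  by rewrite -mulr_sumr sum_back mulr1.
pose J' b c y := J b c y + if b == s then Jt c y
                           else mu' c * unif R (nb d b c :&: U) y.
exists (fun c => m c + mu' c), mu', J', (~~ s); split=> //.
- split=> [c cM|c|].
  + by rewrite -[leLHS]addr0 lerD ?m0 //; case/andP: (mu'0 c).
  + case: (eqVneq (m c) 0) => [->|/mM//]; rewrite add0r; exact: mu'M.
  + by rewrite big_split /= m1 mu'1 natr1.
- split=> [b c y|b c y|b c].
  + rewrite /J' -[L.+2%:R]natr1 mulrDl mul1r.
    have /andP[h1 h2] := J0 b c y.
    have /andP[h3 h4] : 0 <= (if b == s then Jt c y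
       else mu' c * unif R (nb d b c :&: U) y) <= 2 / (g * N ^+ 2).
      by case: eqP => _; [rewrite Jt0 Jt_le | apply: spread_bd].
    by rewrite addr_ge0 // lerD.
  + rewrite /J'; case: (eqVneq (J b c y) 0) => [->|/Jsupp//]; rewrite add0r.
    case: (b =P s) => [->|_]; rewrite mulf_eq0 negb_or => /andP[h1 h2]; last first.
      exact: spread_supp h2.
    have /andP[_ ->] := back_supp _ _ _ h2; move: h1.
    by rewrite /la; case: (y \in U) => //; rewrite mul0r eqxx.
  + rewrite big_split /= Jrow; congr (_ + _); case: eqP => // _.
- split=> y; rewrite /J' big_split /=.
    rewrite (_ : (~~ s == s) = false); last by case: (s).
    by rewrite lerD2r.
  rewrite negbK eqxx /Jt -mulr_sumr sum_back mulr1.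
  (* On [U] the surplus [nu] and its repair [la] add up to exactly [2 / N]. *)
  apply: (le_trans (lerD (Js y) (lexx _))); rewrite -/(nu y) laE.
  rewrite addrACA subrr addr0 -[L.+3%:R]natr1 -[L.+2%:R]natr1.
  have : (y \in U)%:R * (2 / N) <= 2 / N.
    by rewrite ler_piMl ?lern1 ?leq_b1 // divr_ge0 // ltW.
  move=> h; apply: (le_trans (lerD (lexx _) h)).
  by rewrite -mulrDl -addrA ler_pM2r ?invr_gt0.
Qed.

(** The chain is normalised by [L.+1]. At its end the surplus over [L.+1 / N] is at most [2 / N] at
    each vertex, a relative error of [2 / L.+1]. Dividing the rows by [m c >= N^-1] costs a factor
    [N] in the pointwise bound. *)
Lemma restart_kernel (R : realFieldType) (V : finType) (d : rel V)
    (U M : {set V}) (g : R) (L : nat) :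
  let N : R := #|U|%:R in
  0 < g -> g <= 2^-1 -> 0 < N -> M \subset U ->
  (forall b x, (2^-1 + g) * N <= #|nb d b x :&: U|%:R) ->
  (2^-1 + g) * N <= #|M|%:R ->
  exists (m : V -> R) (Q : bool -> V -> V -> R),
  [/\ forall c, 0 <= m c, forall c, m c != 0 -> c \in M, \sum_c m c = 1,
      arc_kernel d U M (2 * L.+1%:R / (g * N)) Q &
      forall b y, \sum_c m c * Q b c y <= (1 + 2 / L.+1%:R) / N].
Proof.
move=> N g0 g2 N0 MU deg Mb.
have [m [mu [J [s [[mu0 muM mu1] [m0 mM m1] [J0 Jsupp Jrow] [Js Jns]]]]]] :=
  @restart_chain R V d U M g L g0 g2 N0 MU deg Mb.
have Ni : 0 < N^-1 by rewrite invr_gt0.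
have mp c : c \in M -> 0 < m c by move=> /m0; apply: lt_le_trans.
have m00 c : 0 <= m c.
  case: (eqVneq (m c) 0) => [->//|/mM/mp]; exact: ltW.
have L0 : 0 < (L.+1%:R : R) by rewrite ltr0n.
have nu_le y : \sum_c mu c * unif R (nb d s c :&: U) y <= 2 / N.
  have -> : 2 / N = \sum_c mu c * (2 / N) by rewrite -mulr_suml mu1 mul1r.
  apply: ler_sum => c _; have /andP[h _] := mu0 c; rewrite ler_wpM2l //.
  have -> : 2 / N = (2^-1 * N)^-1 by rewrite invfM invrK.
  apply: unif_le; first by rewrite mulr_gt0 // invr_gt0.
  apply: le_trans (deg s c); rewrite ler_pM2r // lerDl; exact: ltW.
have col b y : \sum_c J b c y <= (L.+1%:R + 2) / N.
  case: (eqVneq b s) => [->|/negPf bs].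
    apply: (le_trans (Js y)); rewrite mulrDl lerD2l //.
  have -> : b = ~~ s by case: (b) (s) bs => [] [].
  apply: (le_trans (Jns y)); rewrite ler_pM2r // -[L.+2%:R]natr1 lerD2l.
  by rewrite ler1n.
exists (fun c => m c / L.+1%:R), (fun b c y => J b c y / m c); split.
- by move=> c; rewrite divr_ge0.
- by move=> c; rewrite mulf_eq0 negb_or => /andP[/mM].
- by rewrite -mulr_suml m1 divff // gt_eqF.
- split=> [b c y|b c y|b c cM].
  + have /andP[h1 h2] := J0 b c y; rewrite divr_ge0 //=.
    case: (eqVneq (m c) 0) => [->|/mM/m0 mc].
      by rewrite invr0 mulr0 divr_ge0 ?mulr_ge0 // ltW.
    rewrite ler_pdivrMr ?(lt_le_trans Ni) //; apply: (le_trans h2).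
    apply: (@le_trans _ _ (2 * L.+1%:R / (g * N) * N^-1)).
      rewrite le_eqVlt; apply/orP; left; apply/eqP; field.
      by rewrite !gt_eqF.
    by rewrite ler_wpM2l // divr_ge0 ?mulr_ge0 // ltW.
  + by rewrite mulf_eq0 negb_or => /andP[/Jsupp].
  + by rewrite -mulr_suml Jrow divff // gt_eqF ?mp.
- move=> b y; rewrite (_ : \sum_c _ = (\sum_c J b c y) / L.+1%:R).
    apply: (@le_trans _ _ ((L.+1%:R + 2) / N / L.+1%:R)).
      by rewrite ler_pM2r ?invr_gt0.
    by rewrite le_eqVlt; apply/orP; left; apply/eqP; field; rewrite nat1r !gt_eqF.
  rewrite mulr_suml; apply: eq_bigr => c _.
  case: (eqVneq (m c) 0) => [mc|mc]; last by field; rewrite nat1r mc gt_eqF.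
  have := Jrow b c; rewrite mc => /eqP; rewrite psumr_eq0; last first.
    by move=> z _; case/andP: (J0 b c z).
  by move=> /allP/(_ y); rewrite mem_index_enum => /(_ isT)/eqP->; rewrite !mul0r.
Qed.

(** * Embedding one piece *)

(** One step of conditional expectations: if every admissible [y] cost more than [b] times the mean,
    then the mass of at least [b^-1] outside [F] would alone exceed the mean. *)
Lemma exists_low_cost (R : realFieldType) (V : finType) (p h : V -> R)
    (F : {set V}) (b : R) :
  (forall y, 0 <= p y) -> (forall y, 0 <= h y) -> 0 < b ->
  b^-1 <= \sum_(y in ~: F) p y ->
  exists y, [/\ y \notin F, p y != 0 & h y <= b * \sum_y p y * h y].
Proof.
move=> p0 h0 b0 hb; set A := \sum_y p y * h y.
case: (boolP [exists y, [&& y \notin F, p y != 0 & h y <= b * A]]).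
  by move=> /existsP[y /and3P[? ? ?]]; exists y.
rewrite negb_exists => /forallP none.
have big y : y \notin F -> p y != 0 -> b * A < h y.
  by move=> yF py; have := none y; rewrite yF py /= -ltNge.
have bi : 0 < b^-1 by rewrite invr_gt0.
have [y0 y0F py0] : exists2 y, y \in ~: F & p y != 0.
  apply/exists_inP; apply: contraTT hb; rewrite negb_exists_in => /forall_inP pz.
  by rewrite big1 -?ltNge // => y /pz; rewrite negbK => /eqP.
have lt1 : \sum_(y in ~: F) p y * (b * A) < \sum_(y in ~: F) p y * h y.
  rewrite (bigD1 y0) //= [ltRHS](bigD1 y0) //=; apply: ltr_leD.
    by rewrite ltr_pM2l ?big // ?lt_def ?py0 ?p0 //; rewrite inE in y0F.
  apply: ler_sum => y /andP[yF _]; rewrite inE in yF.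
  case: (eqVneq (p y) 0) => [->|py]; first by rewrite !mul0r.
  by rewrite ler_wpM2l // ltW // big.
have le2 : \sum_(y in ~: F) p y * h y <= A.
  rewrite /A big_mkcond; apply: ler_sum => y _.
  by case: ifP => // _; rewrite mulr_ge0.
have A0 : 0 <= A by apply: sumr_ge0 => y _; rewrite mulr_ge0.
have : A <= \sum_(y in ~: F) p y * (b * A).
  rewrite -mulr_suml mulrA -[leLHS]mul1r ler_wpM2r //.
  by rewrite -(ler_pM2r b0) mulVf ?gt_eqF in hb.
by rewrite leNgt (lt_le_trans lt1 le2).
Qed.

(* The vertex of largest rank is a leaf.  Its cost is first moved to its
   parent, averaged by the kernel; once the rest is embedded, some free image
   of the leaf costs no more than that average times b. *)
Lemma embed_piece (R : realFieldType) (T V : finType) (d : rel V)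
    (U M : {set V}) (B b beta : R) (s : nat) (m : V -> R)
    (P Q : bool -> V -> V -> R)
    (par : T -> T) (sg : T -> bool) (rk dep : T -> nat) (c : T) :
  arc_kernel d U U B P -> (forall b y, \sum_(x in U) P b x y <= 1) ->
  arc_kernel d U M B Q -> (forall b y, \sum_x m x * Q b x y <= beta) ->
  (forall x, 0 <= m x) -> (forall x, m x != 0 -> x \in M) -> \sum_x m x = 1 ->
  M \subset U -> 0 <= beta -> 0 <= B -> 0 < b -> b^-1 <= 1 - B * s%:R ->
  dep c = 0%N ->
  forall (S : {set T}) (h : T -> V -> R) (g : V -> R),
  c \notin S -> (forall i, i \in S -> par i \in c |: S) ->
  (forall i, i \in S -> rk (par i) < rk i)%N ->
  (forall i, i \in S -> dep i = (dep (par i)).+1) -> (#|S| <= s)%N ->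
  (forall i y, 0 <= h i y) -> (forall y, 0 <= g y) ->
  exists f : T -> V,
  [/\ f c \in M, forall i, i \in S -> f i \in U, {in c |: S &, injective f},
      forall i, i \in S -> arc d (sg i) (f (par i)) (f i) &
      g (f c) + \sum_(i in S) h i (f i) <= \sum_x m x * g x +
        beta * \sum_(i in S) b ^+ dep i * \sum_(y in U) h i y].
Proof.
move=> [P0 Psupp Prow] Pcol [Q0 Qsupp Qrow] Qcol m0 mM m1 MU beta0 B0 b0 bB depc.
(* The costs stay general in the induction, since removing a leaf changes the cost of its parent;
   [g] collects what reaches the root [c]. *)
move=> S; move: {2}#|S| (erefl #|S|) => n; elim: n S => [|n IH] S cS h g cnS pS rkS dS sS h0 g0.
  move/cards0_eq: cS => SE; rewrite SE.
  have [|x [_ mx gx]] := @exists_low_cost R V m g set0 1 m0 g0 ltr01.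
    by rewrite invr1 -[leLHS]m1 [leRHS]big_mkcond /=; apply: ler_sum => x _; rewrite !inE.
  exists (fun=> x); split=> //; first exact: mM.
  - by move=> i; rewrite inE.
  - by move=> i j; rewrite !inE !orbF => /eqP-> /eqP->.
  - by move=> i; rewrite inE.
  - by rewrite !big_set0 mulr0 !addr0 -[leRHS]mul1r.
have [i0 i0S] : exists i, i \in S by apply/card_gt0P; rewrite cS.
pose i := [arg max_(i > i0 in S) rk i]%N.
have [iS imax] : i \in S /\ forall j, j \in S -> (rk j <= rk i)%N.
  by rewrite /i; case: arg_maxnP.
clearbody i; pose S' := S :\ i.
have S'S j : j \in S' -> j \in S by rewrite inE => /andP[].
have ci : c != i by apply: contraNneq cnS => ->.
have pi_i : par i != i by apply/eqP => h'; have := rkS _ iS; rewrite h' ltnn.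
have cS' : #|S'| = n by apply/eqP; rewrite -eqSS -cS (cardsD1 i S) iS.
have piS : par i \in c |: S'.
  by have := pS _ iS; rewrite !inE pi_i.
(* Children of the root leave the distribution [m] by [Q]; deeper vertices continue by the walk
   [P]. *)
pose k := if par i == c then Q (sg i) else P (sg i).
have k0 x y : 0 <= k x y <= B by rewrite /k; case: ifP.
have ksupp x y : k x y != 0 -> arc d (sg i) x y && (y \in U).
  by rewrite /k; case: ifP => _; [apply: Qsupp | apply: Psupp].
pose push x := b * \sum_y k x y * h i y.
have push0 x : 0 <= push x.
  apply: mulr_ge0; first exact: ltW.
  apply: sumr_ge0 => y _; rewrite mulr_ge0 //.
  by case/andP: (k0 x y).
pose h' j x := h j x + if j == par i then push x else 0.
pose g' x := g x + if par i == c then push x else 0.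
have [|||||||f [fM fU finj farc fcost]] := IH S' cS' h' g'.
- by rewrite !inE (negbTE cnS) andbF.
- move=> j jS'; have jS := S'S _ jS'; have := pS _ jS; rewrite !inE.
  case: (par j =P i) => [pji|_ //]; have := rkS _ jS.
  by rewrite pji ltnNge imax.
- by move=> j' /S'S jS; apply: rkS.
- by move=> j' /S'S jS; apply: dS.
- by rewrite cS' (leq_trans _ sS) // cS.
- by move=> j y; rewrite addr_ge0 //; case: ifP.
- by move=> y; rewrite addr_ge0 //; case: ifP.
pose x := f (par i).
have krow : \sum_y k x y = 1.
  rewrite /k /x; case: eqP => [->|/eqP pic]; first exact: Qrow.
  apply: Prow; move: piS; rewrite in_setU1 (negbTE pic) /=; exact: fU.
pose F := f @: (c |: S').
have [||y [yF ky hy]] := @exists_low_cost R V (k x) (h i) F b _ (h0 i) b0.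
- by move=> y; case/andP: (k0 x y).
(* [F] has at most [s] elements, each of kernel weight at most [B], so at least [1 - B * s] of the
   mass avoids it. *)
- apply: (le_trans bB); rewrite lerBlDr -[leLHS]krow.
  rewrite [leLHS](bigID (mem F)) /= addrC lerD //.
    by rewrite le_eqVlt; apply/orP; left; apply/eqP/eq_bigl => y; rewrite !inE.
  apply: (@le_trans _ _ (\sum_(y in F) B)).
    by apply: ler_sum => y _; case/andP: (k0 x y).
  rewrite sumr_const -[leLHS]mulr_natr ler_wpM2l //.
  rewrite ler_nat (leq_trans (leq_imset_card _ _)) // cardsU1.
  by rewrite (leq_trans _ sS) // cS -cS' -(add1n #|S'|) leq_add2r leq_b1.
have /andP[xy yU] := ksupp _ _ ky.
pose f2 j := if j == i then y else f j.
have f2E j : j != i -> f2 j = f j by rewrite /f2 => /negbTE->.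
have f2i : f2 i = y by rewrite /f2 eqxx.
have memF j : j \in c |: S -> j != i -> f j \in F.
  by move=> jS ji; apply: imset_f; move: jS; rewrite !inE ji.
exists f2; split.
- by rewrite f2E.
- move=> j jS; rewrite /f2; case: eqP => // /eqP ji.
  by apply: fU; rewrite !inE ji.
- move=> j1 j2 h1 h2; rewrite /f2; case: eqP => [->|/eqP n1]; case: eqP => [->|/eqP n2] //.
  + by move=> yE; have := memF _ h2 n2; rewrite -yE (negbTE yF).
  + by move=> yE; have := memF _ h1 n1; rewrite yE (negbTE yF).
  + by apply: finj; rewrite !inE ?n1 ?n2 -in_setU1.
- move=> j jS; case: (eqVneq j i) => [->|ji]; first by rewrite f2i f2E.
  have jS' : j \in S' by rewrite !inE ji.
  rewrite (f2E j) // f2E; first exact: farc.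
  apply/eqP => pji; have := rkS _ jS.
  by rewrite pji ltnNge imax.
rewrite f2E // (bigD1 i) //= f2i.
have SE (G : T -> R) : \sum_(j in S | j != i) G j = \sum_(j in S') G j.
  by apply: eq_bigl => j; rewrite !inE andbC.
have hf2 : \sum_(j in S') h j (f2 j) = \sum_(j in S') h j (f j).
  by apply: eq_bigr => j; rewrite in_setD1 => /andP[ji _]; rewrite f2E.
rewrite SE hf2.
have Sbig (G : T -> R) : \sum_(j in S) G j = G i + \sum_(j in S') G j.
  by rewrite (bigD1 i) //= SE.
rewrite Sbig mulrDr.
have hle : h i y <= push x := hy.
have ksum (w : V -> R) z : (forall x, 0 <= w x) ->
    (forall y, \sum_x w x * k x y <= z) -> 0 <= z ->
    \sum_x w x * push x <= z * b * \sum_(y in U) h i y.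
  move=> w0 wz z0; rewrite /push.
  under eq_bigr do rewrite mulrCA mulr_sumr.
  rewrite -mulr_sumr exchange_big /= [z * b]mulrC -mulrA ler_pM2l //.
  rewrite mulr_sumr [leRHS]big_mkcond /=; apply: ler_sum => y' _.
  under eq_bigr do rewrite mulrA.
  rewrite -mulr_suml; case: ifP => yU'; first by rewrite ler_wpM2r.
  rewrite big1 ?mul0r // => x' _; apply/eqP; rewrite mulf_eq0; apply/orP; right.
  by apply: contraFT yU' => /ksupp/andP[].
(* At the root, the column bound [beta] of [Q] enters. Further down [P] has column sums at most 1,
   so each level only adds a factor [b]. *)
case: (eqVneq (par i) c) => [pic|pic].
- have di : dep i = 1%N by rewrite dS // pic depc.
  have fc' : g' (f c) = g (f c) + push x by rewrite /g' pic eqxx /x pic.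
  have hE j z : j \in S' -> h' j z = h j z.
    rewrite /h' pic; case: eqP => [->|_ _]; last by rewrite addr0.
    by rewrite !inE (negbTE cnS) andbF.
  have e1 : \sum_(j in S') h' j (f j) = \sum_(j in S') h j (f j).
    by apply: eq_bigr => j /hE->.
  have e2 : \sum_(j in S') b ^+ dep j * \sum_(z in U) h' j z =
            \sum_(j in S') b ^+ dep j * \sum_(z in U) h j z.
    by apply: eq_bigr => j jS'; congr (_ * _); apply: eq_bigr => z _; rewrite hE.
  have e3 : \sum_x m x * g' x = \sum_x m x * g x + \sum_x m x * push x.
    by rewrite -big_split /=; apply: eq_bigr => z _; rewrite /g' pic eqxx mulrDr.
  have e4 := ksum m beta m0.
  move: fcost; rewrite fc' e1 e2 e3 di expr1.
  have := e4 _ beta0; rewrite {1}/k pic eqxx => /(_ (Qcol _)).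
  move: hle; rewrite [beta * (b * _)]mulrA; lra.
- have piS' : par i \in S' by move: piS; rewrite in_setU1 (negbTE pic).
  have fc' z : g' z = g z by rewrite /g' (negbTE pic) addr0.
  have e1 : \sum_(j in S') h' j (f j) = \sum_(j in S') h j (f j) + push x.
    rewrite big_split /=; congr (_ + _).
    rewrite (bigD1 (par i)) //= eqxx big1 ?addr0 // => j /andP[_ /negbTE->] //.
  have e2 : \sum_(j in S') b ^+ dep j * \sum_(z in U) h' j z =
      \sum_(j in S') b ^+ dep j * \sum_(z in U) h j z +
      b ^+ dep (par i) * \sum_(z in U) push z.
    under eq_bigr do rewrite big_split /= mulrDr.
    rewrite big_split /=; congr (_ + _).
    rewrite (bigD1 (par i)) //= eqxx [X in _ + X]big1 ?addr0 // => j /andP[_ /negbTE->].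
    by rewrite big1 ?mulr0.
  have e3 : \sum_x m x * g' x = \sum_x m x * g x by apply: eq_bigr => z _; rewrite fc'.
  have := ksum (fun x => (x \in U)%:R) 1 (fun x => ler0n _ _).
  have toU (G : V -> R) : \sum_x (x \in U)%:R * G x = \sum_(x in U) G x.
    rewrite [RHS]big_mkcond; apply: eq_bigr => z _.
    by case: ifP => _; rewrite ?mul1r ?mul0r.
  rewrite toU mul1r => /(_ _ ler01) e4.
  have {}e4 : \sum_(z in U) push z <= b * \sum_(z in U) h i z.
    by apply: e4 => z; rewrite toU /k (negbTE pic).
  have e5 : beta * (b ^+ dep (par i) * \sum_(z in U) push z) <=
      beta * (b ^+ dep i * \sum_(z in U) h i z).
    rewrite ler_wpM2l // (dS i) // exprSr -mulrA ler_wpM2l // exprn_ge0 //.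
    exact: ltW.
  move: fcost; rewrite fc' e1 e2 e3 mulrDr; move: hle e5; lra.
Qed.

Lemma arc_kernel_le (R : realFieldType) (V : finType) (d : rel V)
    (U X : {set V}) (B B' : R) (Q : bool -> V -> V -> R) :
  B <= B' -> arc_kernel d U X B Q -> arc_kernel d U X B' Q.
Proof.
move=> BB' [Q0 Qs Qr]; split=> // b x y.
by have /andP[-> /le_trans->] := Q0 b x y.
Qed.

(** * Densities of neighbourhoods and the exponential potential *)

Lemma expR_le_quad (R : realType) (z : R) :
  `|z| <= 2^-1 -> expR z <= 1 + z + 2 * z ^+ 2.
Proof.
rewrite ler_norml => /andP[z1 z2].
have h : 1 - z <= (expR z)^-1 by rewrite -expRN; exact: expR_ge1Dx.
have h0 : 0 < 1 - z by lra.
have e0 := expR_gt0 z.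
have : expR z * (1 - z) <= 1.
  by rewrite -[leRHS](mulfV (lt0r_neq0 e0)) ler_pM2l.
have : 0 <= z ^+ 2 * (1 - 2 * z) by rewrite mulr_ge0 ?sqr_ge0 //; lra.
move=> h1 h2.
rewrite -(ler_pM2r h0); apply: (le_trans h2).
have -> : (1 + z + 2 * z ^+ 2) * (1 - z) = 1 + z ^+ 2 * (1 - 2 * z) by ring.
by rewrite lerDl.
Qed.

Definition density (R : realFieldType) (V : finType) (d : rel V)
    (U : {set V}) (p : bool * V) : R :=
  #|nb d p.1 p.2 :&: U|%:R / #|U|%:R.

Definition potential (R : realType) (V : finType) (d : rel V) (Lam : R)
    (U : {set V}) : R :=
  \sum_p expR (- (Lam * density R d U p)).

Lemma density_bounds (R : realFieldType) (V : finType) (d : rel V)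
    (U : {set V}) p : 0 <= density R d U p <= 1.
Proof.
rewrite /density divr_ge0 ?ler0n //=; case: (posnP #|U|) => [->|U0].
  by rewrite invr0 mulr0 ler01.
by rewrite ler_pdivrMr ?ltr0n // mul1r ler_nat subset_leq_card // subsetIr.
Qed.

(** The hits of [S] are compared with their fair share, [#|S|] times the density. The extra 1 pays
    for the root [c], for which a hit is assumed throughout. *)
Lemma density_remove (R : realFieldType) (T V : finType) (d : rel V)
    (U : {set V}) (f : T -> V) (c : T) (S : {set T}) p :
  c \notin S -> (forall i, i \in c |: S -> f i \in U) ->
  {in c |: S &, injective f} -> (#|S|.+1 < #|U|)%N ->
  forall N' : R, N' = (#|U| - #|S|.+1)%:R ->
  density R d U p - ((\sum_(i in S) (f i \in nb d p.1 p.2)%:R)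
     - #|S|%:R * density R d U p + 1) / N'
  <= density R d (U :\: f @: (c |: S)) p.
Proof.
move=> cS fU finj SU N' N'E; set A := nb _ _ _; set F := f @: _.
have cF : #|F| = #|S|.+1 by rewrite card_in_imset // cardsU1 cS.
have FU : F \subset U by apply/subsetP => _ /imsetP[i iS ->]; exact: fU.
have cU' : #|U :\: F| = (#|U| - #|S|.+1)%N.
  by rewrite cardsD (setIidPr FU) cF.
set H := \sum_(i in S) _.
have hA : (#|A :&: F|%:R : R) <= H + 1.
  have sub : A :&: F \subset f @: (c |: [set i in S | f i \in A]).
    apply/subsetP => y; rewrite inE => /andP[yA /imsetP[i iS yE]].
    rewrite yE; apply: imset_f; move: iS; rewrite !inE.
    by case: eqP => //= _ ->; rewrite -yE in_nb in yA *.
  apply: (@le_trans _ _ (#|c |: [set i in S | f i \in A]|%:R)).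
    by rewrite ler_nat (leq_trans (subset_leq_card sub)) // leq_imset_card.
  rewrite cardsU1 natrD addrC lerD //; last by rewrite lern1 leq_b1.
  rewrite -sumr_mem /H [leRHS]big_mkcond /=; apply: ler_sum => i _.
  by rewrite inE; case: (i \in S).
have hAU : (#|A :&: (U :\: F)|%:R : R) = #|A :&: U|%:R - #|A :&: F|%:R.
  rewrite setIDA cardsD -setIA (setIidPr FU) natrB //.
  by apply: subset_leq_card; apply: setIS.
have N'0 : 0 < N' by rewrite N'E ltr0n subn_gt0.
have UE : (#|U|%:R : R) = N' + #|S|%:R + 1.
  by rewrite N'E natrB ?(ltnW SU) // -natr1; ring.
have U0 : 0 < (#|U|%:R : R) by rewrite ltr0n (leq_ltn_trans _ SU).
rewrite {3}/density -/A cU' -N'E hAU ler_pdivlMr // mulrBl divfK ?gt_eqF //.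
have Y0 := density_bounds R d U p.
have YU : density R d U p * #|U|%:R = #|A :&: U|%:R.
  by rewrite /density divfK // gt_eqF.
move: YU Y0 hA; rewrite UE; set Y := density _ _ _ _ => YU /andP[Y0 _] hA.
rewrite -YU; lra.
Qed.

(* Exponentiating the densities turns "all neighbourhoods stay dense" into one
   real number; to first order its growth is a sum of one cost per embedded
   vertex, which is what embed_piece controls. *)
Lemma embed_piece_potential (R : realType) (T V : finType) (d : rel V)
    (U : {set V}) (g nu Lam kap b B : R) (s K L : nat)
    (par : T -> T) (sg : T -> bool) (rk dep : T -> nat)
    (x0 : V) (c : T) (S : {set T}) :
  0 < g -> g <= 2^-1 -> 0 < nu -> 1 <= g * nu ->
  0 <= Lam -> 0 < kap -> kap <= 1 ->
  2 * L.+1%:R / (g * nu) <= B -> 1 <= b -> b^-1 <= 1 - B * s%:R ->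
  b ^+ K * (1 + 2 / L.+1%:R) <= 1 + kap ->
  Lam * s%:R <= kap / 2 * nu ->
  (forall p, 2^-1 + g <= density R d U p) ->
  nu + #|S|%:R + 1 <= #|U|%:R ->
  c \notin S -> (#|S| <= s)%N ->
  (forall i, i \in S -> [/\ par i \in c |: S, (rk (par i) < rk i)%N,
                            dep i = (dep (par i)).+1 & (dep i <= K)%N]) ->
  dep c = 0%N ->
  exists f : T -> V,
  [/\ arc d (sg c) x0 (f c), forall i, i \in c |: S -> f i \in U,
      {in c |: S &, injective f},
      forall i, i \in S -> arc d (sg i) (f (par i)) (f i) &
      potential d Lam (U :\: f @: (c |: S)) <=
      potential d Lam U * expR (Lam / nu * (1 + 2 * kap * #|S|%:R))].
Proof.
move=> g0 g2 nu0 gnu Lam0 kap0 kap1 hB b1 hb hbK hLam hY hU cS Ss hS depc.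
set m := #|S|%:R : R; set N := #|U|%:R : R.
have m0 : 0 <= m by apply: ler0n.
have N0 : 0 < N by move: hU; rewrite -/m -/N; lra.
have nuN : nu <= N by move: hU; rewrite -/m -/N; lra.
have gN0 : 0 < g * N by rewrite mulr_gt0.
have deg q x : (2^-1 + g) * N <= #|nb d q x :&: U|%:R.
  by have := hY (q, x); rewrite /density ler_pdivlMr.
have gN1 : 1 <= g * N by rewrite (le_trans gnu) // ler_pM2l.
have b0 : 0 < b by apply: lt_le_trans b1.
have B0 : 0 <= B.
  by apply: le_trans hB; rewrite divr_ge0 ?mulr_ge0 ?ler0n // ltW.
have L1 : 1 <= (L.+1%:R : R) by rewrite ler1n.
have BN : 2 * L.+1%:R / (g * N) <= B.
  apply: le_trans hB; rewrite ler_wpM2l ?mulr_ge0 ?ler0n //.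
  by rewrite lef_pV2 ?posrE ?mulr_gt0 // ler_pM2l.
have [P PK Pcol] : exists2 P, arc_kernel d U U B P &
    forall q y, \sum_(x in U) P q x y <= 1.
  (* For [k] the integer part of [g * N], at least 1, one has [g * N < k + 1 <= 2 * k], which puts
     [k^-1] below the bound of the restart kernel. *)
  have := truncn_itv (ltW gN0); set k := Num.truncn _ => /andP[k1 k2].
  have k0 : (0 < k)%N.
    by rewrite lt0n; apply: contraTneq k2 => ->; rewrite -leNgt.
  have [|P PK Pcol] := @walk_kernel R V d U k k0.
    move=> q x _; rewrite -(ler_nat R) natrD !natrM.
    by have := deg q x; rewrite -/N; lra.
  exists P => //; apply: arc_kernel_le PK; apply: le_trans BN.
  have k0' : 0 < (k%:R : R) by rewrite ltr0n.
  have k1' : 1 <= (k%:R : R) by rewrite ler1n.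
  rewrite ler_pdivlMr // mulrC ler_pdivrMr //.
  move: k2; rewrite -natr1; nra.
have [mu [Q [mu0 muM mu1 QK Qcol]]] := @restart_kernel R V d U
  (nb d (sg c) x0 :&: U) g L g0 g2 N0 (subsetIr _ _) deg (deg _ _).
have {}QK := arc_kernel_le BN QK.
pose A (p : bool * V) := nb d p.1 p.2.
pose w p := expR (- (Lam * density R d U p)).
(* Up to a common factor, this is the first-order growth of the potential when [y] is used up. *)
pose h (i : T) (y : V) := \sum_p w p * (y \in A p)%:R.
have w0 p : 0 <= w p by apply: expR_ge0.
have [|||||||f [fM fU finj farc fcost]] := @embed_piece R T V d U _ B b
   ((1 + 2 / L.+1%:R) / N) s mu P Q par sg rk dep c PK Pcol QK Qcol mu0 muM
   mu1 (subsetIr _ _) _ B0 b0 hb depc S h (fun=> 0) cS.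
- by rewrite divr_ge0 ?addr_ge0 ?divr_ge0 ?ler0n // ltW.
- by move=> i /hS[].
- by move=> i /hS[].
- by move=> i /hS[].
- by [].
- by move=> i y; apply: sumr_ge0 => p _; rewrite mulr_ge0.
- by [].
have {}fU i : i \in c |: S -> f i \in U.
  by rewrite in_setU1 => /predU1P[->|/fU//]; move: fM; rewrite inE => /andP[].
exists f; split=> //; first by move: fM; rewrite inE in_nb => /andP[].
pose H p := \sum_(i in S) (f i \in A p)%:R : R.
pose Y p := density R d U p.
have costl : \sum_(i in S) h i (f i) = \sum_p w p * H p.
  rewrite /h exchange_big /=; apply: eq_bigr => p _; by rewrite mulr_sumr.
have costr i : \sum_(y in U) h i y = N * \sum_p w p * Y p.
  rewrite /h exchange_big /= mulr_sumr; apply: eq_bigr => p _.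
  rewrite -mulr_sumr mulrCA; congr (_ * _).
  rewrite /Y /density mulrC divfK ?gt_eqF // -sumr_mem big_mkcond /=.
  by apply: eq_bigr => y _; rewrite in_setI -/(A p); case: (y \in U); rewrite ?andbT ?andbF.
have Yb p : 0 <= Y p <= 1 by apply: density_bounds.
(* In the weighted mean, the piece uses at most [1 + kap] times the fair share of the
   neighbourhoods; [b ^+ K] and the restart error make up the factor [1 + kap]. *)
have cost : \sum_p w p * H p <= (1 + kap) * m * \sum_p w p * Y p.
  move: fcost; rewrite add0r costl.
  have -> : \sum_x mu x * 0 = 0 by rewrite -mulr_suml mulr0.
  rewrite add0r => /le_trans; apply.
  set W := \sum_p w p * Y p.
  have W0 : 0 <= W.
    by apply: sumr_ge0 => p _; rewrite mulr_ge0 //; case/andP: (Yb p).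
  have : \sum_(i in S) b ^+ dep i * \sum_(y in U) h i y <= b ^+ K * m * (N * W).
    rewrite -[b ^+ K * m]mulrC -mulrA /m -sum1_card natr_sum mulr_suml.
    apply: ler_sum => i iS; rewrite mul1r costr ler_wpM2r //.
      by rewrite mulr_ge0 // ltW.
    by have [_ _ _] := hS _ iS; apply: ler_weXn2l.
  move=> hsum.
  apply: (le_trans (ler_wpM2l _ hsum)).
    by rewrite divr_ge0 ?addr_ge0 ?divr_ge0 ?ler0n // ltW.
  have -> : (1 + 2 / L.+1%:R) / N * (b ^+ K * m * (N * W)) =
            b ^+ K * (1 + 2 / L.+1%:R) * (m * W).
    by field; rewrite nat1r !gt_eqF // (lt_le_trans ltr01).
  by rewrite -[leRHS]mulrA ler_wpM2r // mulr_ge0.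
pose N' := (#|U| - #|S|.+1)%:R : R.
have SU : (#|S|.+1 < #|U|)%N.
  by rewrite -(ltr_nat R) -natr1 -/m -/N; move: hU; rewrite -/m -/N; lra.
have N'E : N' = N - m - 1 by rewrite /N' natrB ?(ltnW SU) // -natr1; ring.
have N'nu : nu <= N' by rewrite N'E; move: hU; rewrite -/m -/N; lra.
have N'0 : 0 < N' by apply: lt_le_trans N'nu.
pose th := Lam / N'.
have th0 : 0 <= th by rewrite divr_ge0 // ltW.
have thnu : th <= Lam / nu by rewrite ler_wpM2l // lef_pV2 ?posrE.
have thm : th * m <= kap / 2.
  rewrite /th mulrAC ler_pdivrMr //; apply: (@le_trans _ _ (Lam * s%:R)).
    by rewrite ler_wpM2l // ler_nat.
  by apply: (le_trans hLam); rewrite ler_wpM2l // divr_ge0 // ltW.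
have thm0 : 0 <= th * m by rewrite mulr_ge0.
have Hb p : 0 <= H p <= m.
  rewrite sumr_ge0 //= /m -sum1_card natr_sum.
  by apply: ler_sum => i _; rewrite lern1 leq_b1.
(* [expR th] pays for the root. The remaining exponent is at most [th * m <= kap / 2] in absolute
   value, so the quadratic term of [expR_le_quad] is at most [kap * (th * m)]. *)
have term p : expR (- (Lam * density R d (U :\: f @: (c |: S)) p)) <=
    expR th * (w p * (1 + th * (H p - m * Y p) + kap * (th * m))).
  have := @density_remove R T V d U f c S p cS fU finj SU N' erefl.
  rewrite -/(H p) -/m -/(Y p) => hd.
  have hle : - (Lam * density R d (U :\: f @: (c |: S)) p) <=
      th + (- (Lam * Y p) + th * (H p - m * Y p)).
    rewrite /th; have := ler_wpM2l Lam0 hd.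
    rewrite mulrBr [Lam * (_ / N')]mulrA -[Lam * _ / N']mulrAC; lra.
  apply: (@le_trans _ _ (expR (th + (- (Lam * Y p) + th * (H p - m * Y p))))).
    by rewrite ler_expR.
  rewrite expRD ler_pM2l ?expR_gt0 // expRD ler_wpM2l ?expR_ge0 //.
  have /andP[y0 y1] := Yb p; have /andP[h0 h1] := Hb p.
  have z1 : `|th * (H p - m * Y p)| <= th * m.
    rewrite normrM ger0_norm // ler_wpM2l // ler_norml; nra.
  have hz : `|th * (H p - m * Y p)| <= 2^-1.
    by apply: (le_trans z1); move: thm kap1; lra.
  apply: (le_trans (expR_le_quad hz)).
  rewrite lerD2l.
  have z2 : (th * (H p - m * Y p)) ^+ 2 <= (th * m) ^+ 2.
    by rewrite -real_normK ?num_real // lerXn2r ?nnegrE.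
  have z3 : (th * m) ^+ 2 <= kap / 2 * (th * m) by rewrite expr2 ler_wpM2r.
  apply: (@le_trans _ _ (2 * (kap / 2 * (th * m)))).
    by rewrite ler_pM2l // (le_trans z2).
  by rewrite mulrA [2 * _]mulrC divfK // pnatr_eq0.
apply: (@le_trans _ _ (expR th * \sum_p w p * (1 + th * (H p - m * Y p) + kap * (th * m)))).
  by rewrite mulr_sumr; apply: ler_sum => p _; apply: term.
have -> : potential d Lam U = \sum_p w p by [].
set W := \sum_p w p.
have W0 : 0 <= W by apply: sumr_ge0.
have YW : \sum_p w p * Y p <= W.
  apply: ler_sum => p _; rewrite -[leRHS]mulr1 ler_wpM2l //.
  by case/andP: (Yb p).
have -> : \sum_p w p * (1 + th * (H p - m * Y p) + kap * (th * m)) =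
    W * (1 + kap * (th * m)) + th * (\sum_p w p * H p - m * \sum_p w p * Y p).
  rewrite /W !mulr_suml mulr_sumr -sumrB mulr_sumr -big_split /=.
  by apply: eq_bigr => p _; ring.
(* By [cost] the first-order terms cancel up to [kap * (th * m) * W]; the quadratic error of the
   same size brings the factor 2. *)
apply: (@le_trans _ _ (expR th * (W * (1 + 2 * kap * (th * m))))).
  rewrite ler_pM2l ?expR_gt0 //.
  set a := \sum_p w p * H p in cost *; set e := \sum_p w p * Y p in cost YW *.
  have : th * (a - m * e) <= kap * (th * m) * W.
    apply: (@le_trans _ _ (th * (kap * m * e))).
      by rewrite ler_wpM2l //; lra.
    rewrite (_ : th * (kap * m * e) = kap * (th * m) * e); last by ring.
    by rewrite ler_wpM2l // mulr_ge0 // ltW.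
  lra.
rewrite mulrCA ler_wpM2l //.
apply: (@le_trans _ _ (expR th * expR (2 * kap * (th * m)))).
  by rewrite ler_pM2l ?expR_gt0 // expR_ge1Dx.
rewrite -expRD ler_expR.
have -> : th + 2 * kap * (th * m) = th * (1 + 2 * kap * m) by ring.
by rewrite ler_wpM2r // addr_ge0 // !mulr_ge0 // ltW.
Qed.

(** * Cutting a tree into pieces *)

Section RootedTrees.

Local Open Scope nat_scope.

(** The tree is given by a parent map only, so the recursion runs on fuel; any fuel above [rk i]
    gives the same value at [i]. *)
Lemma rank_recursion_up (T : finType) (A : Type) (par : T -> T) (rk : T -> nat)
    (t : T) (a0 : A) (F : T -> A -> A) :
  (forall i, i != t -> rk (par i) < rk i)%N ->
  exists2 g : T -> A, g t = a0 & forall i, i != t -> g i = F i (g (par i)).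
Proof.
move=> hrk.
pose up := fix up n i := if n is n'.+1 then
  if i == t then a0 else F i (up n' (par i)) else a0.
have upS n i : up n.+1 i = if i == t then a0 else F i (up n (par i)) by [].
have upE n m i : (rk i < n)%N -> (rk i < m)%N -> up n i = up m i.
  elim: n m i => [//|n IH] [//|m] i h1 h2; rewrite !upS; case: (eqVneq i t) => // it.
  by congr F; apply: IH; apply: leq_trans (hrk i it) _.
exists (fun i => up (rk i).+1 i) => [|i it]; first by rewrite upS eqxx.
by rewrite upS (negbTE it); congr F; apply: upE => //; exact: hrk.
Qed.

(** Values now flow from children to parents, so the fuel is measured down from the largest rank;
    the second hypothesis says that [F i] reads only the children of [i]. *)
Lemma rank_recursion_down (T : finType) (A : Type) (par : T -> T)
    (rk : T -> nat) (t : T) (F : T -> (T -> A) -> A) (a0 : A) :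
  (forall i, i != t -> rk (par i) < rk i)%N ->
  (forall i u v, (forall k, k != t -> par k = i -> u k = v k) -> F i u = F i v) ->
  exists g : T -> A, forall i, g i = F i g.
Proof.
move=> hrk Fext.
pose down := fix down n i := if n is n'.+1 then F i (down n') else a0.
pose N := \max_i rk i.
have rkN i : (rk i <= N)%N by apply: leq_bigmax.
have downS n i : down n.+1 i = F i (down n) by [].
have downE n m i : (N < n + rk i)%N -> (N < m + rk i)%N -> down n i = down m i.
  elim: n m i => [|n IH] [|m] i h1 h2.
  - by [].
  - by move: h1; rewrite add0n ltnNge rkN.
  - by move: h2; rewrite add0n ltnNge rkN.
  rewrite !downS; apply: Fext => k kt pk; have := hrk k kt; rewrite pk => hk.
  apply: IH; first by rewrite (leq_trans h1) // addSnnS leq_add2l.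
  by rewrite (leq_trans h2) // addSnnS leq_add2l.
exists (down N.+1) => i; rewrite downS; apply: Fext => k kt pk.
have := hrk k kt => hk; apply: (downE N N.+1); last by rewrite addSn ltnS leq_addr.
by rewrite -addn1 leq_add2l (leq_trans _ hk).
Qed.

Lemma small_residue_class (T : finType) (dp : T -> nat) (K : nat) :
  (0 < K)%N -> exists2 rho : nat, (rho < K)%N &
  (K * #|[set i | dp i %% K == rho]| <= #|T|)%N.
Proof.
case: K => // K _.
pose cl (rho : 'I_K.+1) := #|[set i | dp i %% K.+1 == rho]|.
pose rho := [arg min_(r < ord0) cl r]%N.
exists rho; first exact: ltn_ord.
have rmin r : (cl rho <= cl r)%N by rewrite /rho; case: arg_minnP => // j _; apply.
have -> : #|T| = \sum_r cl r.
  rewrite -sum1_card (partition_big (fun i => inord (dp i %% K.+1) : 'I_K.+1) xpredT) //=.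
  apply: eq_bigr => r _; rewrite /cl -sum1_card; apply: eq_bigl => i.
  rewrite inE -val_eqE /= inordK ?ltn_pmod //.
apply: (@leq_trans (\sum_(r : 'I_K.+1) cl rho)); last exact: leq_sum.
by rewrite sum_nat_const card_ord.
Qed.

Section Pieces.

Variables (T : finType) (par : T -> T) (rk : T -> nat) (t : T).
Variables (Delta s K : nat).
Hypothesis rk_par : forall i, i != t -> (rk (par i) < rk i)%N.
Hypothesis kids_le : forall p, (#|[set k | (k != t) && (par k == p)]| <= Delta)%N.
Hypotheses (s_gt0 : (0 < s)%N) (K_gt0 : (0 < K)%N).

(* r i counts the descendants of i that remain attached to i when the children
   of every heavy vertex (one with r >= s) are cut off; summing the recursion
   for r over all vertices bounds the number of heavy vertices. *)
Lemma heavy_vertices : exists r : T -> nat,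
  let res i := if (s <= r i)%N then 1%N else r i in
  (forall i, r i = (\sum_(k | (k != t) && (par k == i)) res k).+1) /\
  (#|[set i | (s <= r i)%N]| * s.-1 <= #|T|)%N.
Proof.
have [|r rE] := @rank_recursion_down T nat par rk t
  (fun i r => (\sum_(k | (k != t) && (par k == i))
                 (if (s <= r k)%N then 1%N else r k)).+1) 0%N rk_par.
  move=> i u v uv; congr _.+1; apply: eq_bigr => k /andP[kt /eqP pk].
  by rewrite uv.
exists r => res; split=> //.
have tot : (\sum_i r i = #|T| + \sum_(k | k != t) res k)%N.
  have -> : #|T| = \sum_(i : T) 1 by rewrite sum_nat_const muln1.
  rewrite [X in _ = _ + X](partition_big par xpredT) //= -big_split /=.
  by apply: eq_bigr => i _; rewrite {1}rE add1n.
(* A heavy vertex collects at least [s] and passes on 1, so it absorbs at least [s.-1]; by [tot] the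
   total absorbed is at most [#|T|]. *)
have low : (\sum_i (res i + (s <= r i)%N * s.-1) <= \sum_i r i)%N.
  apply: leq_sum => i _; rewrite /res; case: (leqP s (r i)) => [|_] /=; last by rewrite mul0n addn0.
  by rewrite mul1n add1n prednK.
have hv : (\sum_i (s <= r i)%N = #|[set i | (s <= r i)%N]|)%N.
  rewrite -sum1_card [RHS]big_mkcond /=; apply: eq_bigr => i _; rewrite inE.
  by case: leqP.
move: low; rewrite big_split /= -big_distrl /= hv tot (bigD1 t) //=.
set a := (#|_| * _)%N; set b := \sum_(i | _) _; lia.
Qed.

(** The depth class bounds the depth of a piece, and cutting below heavy vertices bounds its size.
    The children of [t] are cut as well, so that [t], whose image is prescribed, forms a piece by
    itself. *)
Lemma tree_pieces : exists (C : {set T}) (root : T -> T) (dep : T -> nat),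
  [/\ t \in C /\ (forall i, i != t -> par i = t -> i \in C),
      forall i, i \in C -> root i = i /\ dep i = 0%N,
      forall i, i \notin C -> root i = root (par i) /\ dep i = (dep (par i)).+1,
      (forall i, dep i <= K)%N /\ (forall c, #|[set i | root i == c]| <= s)%N &
      exists q H : nat, [/\ (q * K <= #|T|)%N, (H * s.-1 <= #|T|)%N &
        (#|C| <= 1 + Delta + q + H * Delta)%N]].
Proof.
have [dp dpt dpE] := rank_recursion_up 0%N (fun _ => S) rk_par.
have [rho rhoK rho_le] := small_residue_class dp K_gt0.
have [r [rE heavy_le]] := heavy_vertices.
set res := fun i => if (s <= r i)%N then 1%N else r i in rE.
pose kids p := [set k | (k != t) && (par k == p)].
pose level := [set i | dp i %% K == rho].
pose cut := [set k | (k != t) && (s <= r (par k))%N].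
pose C := t |: (kids t :|: level :|: cut).
have [g gt gE] := rank_recursion_up (t, 0%N)
  (fun i a => if i \in C then (i, 0%N) else (a.1, a.2.+1)) rk_par.
have tC : t \in C by rewrite !inE eqxx.
have gC i : i \in C -> g i = (i, 0%N).
  by case: (eqVneq i t) => [->//|it iC]; rewrite gE // iC.
have nCt i : i \notin C -> i != t by apply: contraNneq => ->.
have gN i : i \notin C -> g i = ((g (par i)).1, (g (par i)).2.+1).
  by move=> iC; rewrite gE ?nCt // (negbTE iC).
exists C, (fun i => (g i).1), (fun i => (g i).2); split.
- by split=> // i it pi; rewrite !inE it pi eqxx /= orbT.
- by move=> i /gC->.
- by move=> i /gN->.
- split.
  (* The right-hand side counts the levels since the last depth congruent to [rho]; it returns to 0
     exactly where all vertices are cut. *)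
  + have key n i : (rk i < n)%N -> ((g i).2 <= (dp i + (K - rho)) %% K)%N.
      elim: n i => // n IH i; rewrite ltnS => rin.
      case: (boolP (i \in C)) => [/gC->//|iC]; have it := nCt _ iC.
      have := IH (par i) (leq_trans (rk_par it) rin).
      have il : dp i %% K != rho.
        by apply: contraNneq iC => il; rewrite !inE il eqxx !orbT.
      rewrite (gN i iC) /= (dpE i it); move: il; rewrite (dpE i it).
      set D := dp (par i); set G := (g _).2.
      have KE : K = (K - rho + rho)%N by rewrite subnK // ltnW.
      move=> il hG; rewrite addSn modnS; case: ifP => // dv.
      move: il; rewrite -[X in _ != X](modn_small rhoK) -(eqn_modDr (K - rho)).
      by rewrite subnKC ?(ltnW rhoK) // modnn addSn -/(dvdn _ _) dv.
    move=> i; apply: (leq_trans (key _ i (leqnn _))).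
    by rewrite ltnW // ltn_pmod.
  + move=> c; set comp := [set i | _].
    have res1 i : (0 < res i)%N by rewrite /res; case: (leqP s (r i)) => // _; rewrite rE.
    have ress i : (res i <= s)%N by rewrite /res; case: (leqP s (r i)) => // /ltnW.
    case: (set_0Vmem comp) => [->|[i0 i0c]]; first by rewrite cards0.
    have rootC n i : (rk i < n)%N -> (g i).1 \in C.
      elim: n i => // n IH i; rewrite ltnS => rin.
      case: (boolP (i \in C)) => iC; first by rewrite gC.
      by rewrite gN //; apply: IH; apply: leq_trans rin; exact/rk_par/nCt.
    have cC : c \in C.
      by move: i0c; rewrite inE => /eqP<-; apply: rootC (ltnSn _).
    have cc : c \in comp by rewrite inE gC //=.
    have compN k : k \in comp -> k != c -> k \notin C.
      by rewrite inE => kc; apply: contraNN => kC; move: kc; rewrite gC.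
    have compP k : k \in comp -> k != c -> (k != t) && (par k \in comp).
      move=> kc kn; have kC := compN _ kc kn; rewrite nCt //=.
      by move: kc; rewrite !inE gN.
    (* Summed over the piece, the terms [res k] with [k != c] cancel, which leaves
       [#|comp| <= res c <= s]. A heavy vertex has no child in its own piece. *)
    have up i : i \in comp ->
        (1 + \sum_(k | (k \in comp) && (k != c) && (par k == i)) res k <= res i)%N.
      move=> ic; rewrite {2}/res; case: (leqP s (r i)) => hi.
        rewrite big1 // => k /andP[/andP[kc kn] /eqP pk].
        have := compN _ kc kn; rewrite !inE pk hi.
        by have /andP[->] := compP _ kc kn; rewrite !orbT.
      rewrite rE add1n ltnS [leqLHS]big_mkcond [leqRHS]big_mkcond /=.
      apply: leq_sum => k _; case: ifP => // /andP[/andP[kc kn] ->].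
      by have /andP[->] := compP _ kc kn.
    have : (\sum_(i in comp) (1 + \sum_(k | (k \in comp) && (k != c)
             && (par k == i)) res k) <= \sum_(i in comp) res i)%N.
      exact: leq_sum.
    rewrite big_split /= sum1_card -(partition_big par (mem comp)) /=; last first.
      by move=> k /andP[kc kn]; have /andP[] := compP _ kc kn.
    rewrite [leqRHS](bigD1 c) //= leq_add2r => /leq_trans; exact.
- exists #|level|, #|[set i | (s <= r i)%N]|; split=> //.
    by rewrite mulnC.
  have cutE : (#|cut| <= #|[set i | (s <= r i)%N]| * Delta)%N.
    rewrite -sum1_card (partition_big par (fun i => s <= r i)%N) /=; last first.
      by move=> k; rewrite inE => /andP[].
    apply: (@leq_trans (\sum_(i | (s <= r i)%N) Delta)).
      apply: leq_sum => i _; rewrite sum1_card.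
      apply: leq_trans (kids_le i); apply/subset_leq_card/subsetP => k.
      by rewrite unfold_in !inE => /andP[/andP[-> _] ->].
    rewrite sum_nat_const leq_mul2r; apply/orP; right.
    by apply: eq_leq; apply: eq_card => i; rewrite inE.
  apply: (leq_trans (leq_card_setU _ _).1); rewrite cards1 -!addnA leq_add2l.
  apply: (leq_trans (leq_card_setU _ _).1); rewrite addnA leq_add //.
  apply: (leq_trans (leq_card_setU _ _).1); rewrite leq_add //.
  exact: kids_le.
Qed.

End Pieces.

End RootedTrees.

(* S is grown one vertex at a time.  A new vertex with two neighbours in S
   would close a cycle through the connected set S. *)
Lemma tree_growth (T : finType) (e : rel T) (t : T) (n : nat) :
  is_tree e -> (n < #|T|)%N ->
  exists (S : {set T}) (par : T -> T) (rk : T -> nat),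
  [/\ t \in S /\ #|S| = n.+1,
      forall i, i \in S -> (rk i <= n)%N /\
        (i != t -> [/\ par i \in S, (rk (par i) < rk i)%N & e (par i) i]),
      {in S &, injective rk},
      forall x y, x \in S -> y \in S -> e x y ->
        (y != t /\ par y = x) \/ (x != t /\ par x = y) &
      forall x, x \in S -> connect [rel x y | [&& e x y, x \in S & y \in S]] t x].
Proof.
case=> eirr esym [_ econn] eacy; elim: n => [_|n IH nT].
  exists [set t], id, (fun=> 0%N); split.
  - by rewrite inE eqxx cards1.
  - by move=> i; rewrite inE => /eqP->; rewrite eqxx.
  - by move=> i j; rewrite !inE => /eqP-> /eqP->.
  - by move=> x y; rewrite !inE => /eqP-> /eqP->; rewrite eirr.
  - by move=> x; rewrite inE => /eqP->; exact: connect0.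
have [S [par [rk [[tS cS] hS rkI hE conn]]]] := IH (ltnW nT).
pose eS := [rel x y | [&& e x y, x \in S & y \in S]].
have eSsym : symmetric eS by move=> x y /=; rewrite esym andbCA andbA andbC andbA andbC.
have [k kS [p pS epk]] : exists2 k, k \notin S & exists2 p, p \in S & e p k.
  have [z zS] : exists z, z \notin S.
    apply/existsP; rewrite -negb_forall; apply: contraTN nT => /forallP aS.
    by rewrite -leqNgt -cS; apply: subset_leq_card; apply/subsetP => y _; apply: aS.
  have exits q x : x \in S -> path e x q -> z = last x q ->
      exists2 k, k \notin S & exists2 p, p \in S & e p k.
    elim: q x => [|y q IHq] x xS /=; first by move=> _ zx; rewrite zx xS in zS.
    case/andP=> exy qp zE; case: (boolP (y \in S)) => [yS|yS].
      exact: (IHq y).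
    by exists y => //; exists x.
  by have /connectP[q qp zE] := econn t z; apply: exits qp zE.
have uniq_p p' : p' \in S -> e p' k -> p' = p.
  move=> p'S ep'k; apply/eqP/negPn/negP => np.
  have : connect eS p p'.
    by apply: connect_trans (conn _ p'S); rewrite (sym_connect_sym eSsym) conn.
  case/connectP=> q0 q0p q0E; case/shortenP: q0p q0E => q qp qU _ qE.
  have qS : all (mem S) q.
    elim: q p pS {np epk qU qE} qp => //= y q IHq x xS /andP[/and3P[_ _ yS] qp].
    by rewrite yS (IHq y).
  apply: (eacy (k :: p :: q)); first by case: (q) qE np => //= ->; rewrite eqxx.
  rewrite /ucycle /= rcons_path -qE esym epk ep'k andbT; apply/andP; split.
    by apply: sub_path qp => x y /and3P[].
  move: qU => /= ->; rewrite andbT; apply: contraNN kS.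
  by rewrite inE => /predU1P[->//|/(allP qS)].
have kt : k != t by apply: contraNneq kS => ->.
pose par' i := if i == k then p else par i.
pose rk' i := if i == k then n.+1 else rk i.
have nk i : i \in S -> (i == k) = false.
  by move=> iS; apply/negbTE; apply: contraNneq kS => <-.
have rkn i : i \in S -> (rk i < n.+1)%N by move=> /hS[].
exists (k |: S), par', rk'; split.
- by rewrite in_setU1 tS orbT cardsU1 kS cS.
- move=> i; rewrite in_setU1 /rk' /par' => /predU1P[->|iS].
    by rewrite eqxx nk // rkn // in_setU1 pS orbT epk.
  rewrite nk // (ltnW (rkn _ iS)); split=> // it.
  have [_ /(_ it)[h1 h2 h3]] := hS _ iS.
  by rewrite nk // in_setU1 h1 orbT.
- move=> i j; rewrite !in_setU1 /rk' => /predU1P[->|iS] /predU1P[->|jS] //.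
  + by rewrite eqxx nk // => h; have := rkn _ jS; rewrite -h ltnn.
  + by rewrite eqxx nk // => h; have := rkn _ iS; rewrite h ltnn.
  + by rewrite !nk //; apply: rkI.
- move=> x y; rewrite !in_setU1 /par' => /predU1P[->|xS] /predU1P[->|yS].
  + by rewrite eirr.
  + by rewrite esym eqxx => /(uniq_p _ yS)->; right.
  + by rewrite eqxx => /(uniq_p _ xS)->; left.
  + by rewrite !nk //; apply: hE.
- have sub : subrel (connect eS) (connect [rel x y | [&& e x y, x \in k |: S & y \in k |: S]]).
    apply: connect_sub => x y /and3P[exy xS yS]; apply: connect1.
    by rewrite /= exy !in_setU1 xS yS !orbT.
  move=> x; rewrite in_setU1 => /predU1P[->|xS]; last exact/sub/conn.
  apply: connect_trans (sub _ _ (conn _ pS)) (connect1 _).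
  by rewrite /= epk !in_setU1 pS eqxx orbT.
Qed.

(** Every arc of [r] joins a vertex to its parent, and by antisymmetry the single bit [r (par i) i]
    determines its direction. Hence checking the signed parent edges suffices for a homomorphism. *)
Lemma tree_rooting (T : finType) (r : rel T) (t : T) :
  is_oriented_tree r ->
  exists (par : T -> T) (sg : T -> bool) (rk : T -> nat),
  [/\ injective rk, forall i, i != t -> (rk (par i) < rk i)%N,
      forall p, (#|[set k | (k != t) && (par k == p)]| <= max_underlying_deg r)%N &
      forall (V : finType) (d : rel V) (f : T -> V),
        (forall i, i != t -> arc d (sg i) (f (par i)) (f i)) ->
        forall x y, r x y -> d (f x) (f y)].
Proof.
case=> rirr ranti rtree.
have T0 : (0 < #|T|)%N by apply/card_gt0P; exists t.
have [|S [par [rk [[tS cS] hS rkI hE _]]]] := @tree_growth T (underlying r) t #|T|.-1 rtree.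
  by rewrite prednK.
have inS x : x \in S.
  have /eqP-> : S == setT by rewrite eqEcard subsetT cardsT cS (ltn_predK T0) leqnn.
  by rewrite inE.
have hpar i : i != t -> (rk (par i) < rk i)%N /\ underlying r (par i) i.
  by move=> it; have [_ /(_ it)[]] := hS _ (inS i).
exists par, (fun i => r (par i) i), rk; split.
- by move=> x y; apply: rkI.
- by move=> i /hpar[].
- move=> p; apply: leq_trans (leq_bigmax p).
  apply/subset_leq_card/subsetP => k; rewrite !inE => /andP[kt /eqP<-].
  by have [] := hpar _ kt.
- move=> V d f hf x y rxy.
  have uxy : underlying r x y by rewrite /underlying rxy.
  have [[yt pyx]|[xt pxy]] := hE x y (inS x) (inS y) uxy.
    by have := hf _ yt; rewrite pyx /arc rxy.
  have := hf _ xt; rewrite pxy /arc; case: ifP => // ryx.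
  have xy : x = y by apply: ranti; rewrite rxy ryx.
  by move: rxy; rewrite xy rirr.
Qed.

(** * Embedding the whole tree *)

Lemma density_ge_potential (R : realType) (V : finType) (d : rel V)
    (U : {set V}) (Lam a : R) :
  0 < Lam -> potential d Lam U <= expR (- (Lam * a)) ->
  forall p, a <= density R d U p.
Proof.
move=> Lam0 hpot p; rewrite -(ler_pM2l Lam0) -lerN2 -ler_expR.
apply: le_trans hpot; rewrite /potential (bigD1 p) //= lerDl.
by apply: sumr_ge0 => q _; apply: expR_ge0.
Qed.

Section EmbedTree.

Variables (R : realType) (T V : finType) (d : rel V) (v : V).
Variables (par : T -> T) (sg : T -> bool) (rk : T -> nat) (t : T).
Variables (C : {set T}) (root : T -> T) (dep : T -> nat).
Variables (g nu Lam kap b B : R) (s K L : nat).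

Hypothesis rk_inj : injective rk.
Hypothesis rk_par : forall i, i != t -> (rk (par i) < rk i)%N.
Hypothesis tC : t \in C.
Hypothesis kidsC : forall i, i != t -> par i = t -> i \in C.
Hypothesis rootC : forall i, i \in C -> root i = i /\ dep i = 0%N.
Hypothesis rootN : forall i, i \notin C ->
  root i = root (par i) /\ dep i = (dep (par i)).+1.
Hypothesis dep_le : forall i, (dep i <= K)%N.
Hypothesis piece_le : forall c, (#|[set i | root i == c]| <= s)%N.

Hypotheses (g_gt0 : 0 < g) (g_le : g <= 2^-1) (nu_gt0 : 0 < nu).
Hypotheses (gnu : 1 <= g * nu) (Lam_gt0 : 0 < Lam).
Hypotheses (kap_gt0 : 0 < kap) (kap_le1 : kap <= 1).
Hypotheses (B_ge : 2 * L.+1%:R / (g * nu) <= B) (b_ge1 : 1 <= b).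
Hypotheses (b_le : b^-1 <= 1 - B * s%:R).
Hypotheses (bK_le : b ^+ K * (1 + 2 / L.+1%:R) <= 1 + kap).
Hypotheses (Lam_s : Lam * s%:R <= kap / 2 * nu).
Hypothesis room : nu + #|T|%:R <= #|V|%:R.
(** The budget of the whole embedding: each piece contributes 1 for its root and [2 * kap] per
    further vertex to the exponent. *)
Hypothesis start : potential d Lam [set~ v] *
  expR (Lam / nu * (#|C|%:R + 2 * kap * #|T|%:R)) <=
  expR (- (Lam * (2^-1 + g))).

Let notC_neq i : i \notin C -> i != t.
Proof. by apply: contraNneq => ->. Qed.

Let root_in i : root i \in C /\ (rk (root i) <= rk i)%N.
Proof.
have [n] := ubnP (rk i); elim: n i => // n IH i; rewrite ltnS => rin.
case: (boolP (i \in C)) => [iC|iC]; first by have [-> _] := rootC iC.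
have ri := rk_par (notC_neq iC); have [-> _] := rootN iC.
have [h1 h2] := IH _ (leq_trans ri rin); split=> //.
exact: leq_trans h2 (ltnW ri).
Qed.

Let root_t i : root i = t -> i = t.
Proof.
have [n] := ubnP (rk i); elim: n i => // n IH i; rewrite ltnS => rin.
case: (boolP (i \in C)) => [iC|iC]; first by have [-> _] := rootC iC.
have it := notC_neq iC; have [-> _] := rootN iC => rt.
have pit := IH _ (leq_trans (rk_par it) rin) rt.
by rewrite (kidsC it pit) in iC.
Qed.

Let rk_t i : (rk t <= rk i)%N.
Proof.
have [n] := ubnP (rk i); elim: n i => // n IH i; rewrite ltnS => rin.
case: (eqVneq i t) => [->//|it].
exact: leq_trans (IH _ (leq_trans (rk_par it) rin)) (ltnW (rk_par it)).
Qed.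

(** Pieces are embedded in the order of the ranks of their roots; [E j] is the part of the tree
    embedded before rank [j]. *)
Let E j := [set i | (rk (root i) < j)%N].

Let good j (f : T -> V) :=
  [/\ f t = v, {in E j &, injective f},
      forall i, i \in E j -> i != t -> arc d (sg i) (f (par i)) (f i) &
      potential d Lam (~: (f @: E j)) <= potential d Lam [set~ v] *
        expR (Lam / nu * (#|C :&: E j|%:R + 2 * kap * #|E j|%:R))].

Let good_start : good (rk t).+1 (fun=> v).
Proof.
have Et : E (rk t).+1 = [set t].
  apply/setP => i; rewrite !inE ltnS; apply/idP/eqP => [h|->].
    by apply: root_t; apply: rk_inj; apply/eqP; rewrite eqn_leq h rk_t.
  by have [-> _] := rootC tC.
rewrite /good Et; split=> //.
- by move=> i j; rewrite !inE => /eqP-> /eqP->.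
- by move=> i; rewrite inE => ->.
- rewrite imset_set1 -[leLHS]mulr1 ler_wpM2l //.
    by apply: sumr_ge0 => p _; apply: expR_ge0.
  rewrite -[leLHS]expR0 ler_expR mulr_ge0 ?divr_ge0 // ?ltW //.
  by rewrite addr_gt0 // ?ltr0n ?mulr_gt0 ?ltr0n ?cards1 // (setIidPr _) ?cards1 // sub1set.
Qed.

(** If [c] of rank [j] is the root of a piece, the piece of its parent has a root of smaller rank,
    so the parent already has an image, and [c] is placed in a neighbourhood of it. *)
Let good_step j f : (rk t < j)%N -> good j f -> exists f', good j.+1 f'.
Proof.
move=> tj [ft finj farc fpot].
case: (boolP [exists c in C, rk c == j]) => [/exists_inP[c cC /eqP rkc]|]; last first.
  rewrite negb_exists_in => /forall_inP noc; exists f.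
  have EE : E j.+1 = E j.
    apply/setP => i; rewrite !inE ltnS leq_eqVlt.
    by have [rC _] := root_in i; rewrite (negbTE (noc _ rC)).
  by rewrite /good EE.
have [rc dc] := rootC cC.
pose Pc := [set i | root i == c]; pose S := Pc :\ c.
have cP : c \in Pc by rewrite inE rc.
have cSE : c |: S = Pc by rewrite setD1K.
have cS : c \notin S by rewrite !inE eqxx.
have EE : E j.+1 = E j :|: Pc.
  apply/setP => i; rewrite !inE ltnS leq_eqVlt orbC; congr (_ || _).
  by rewrite -rkc (inj_eq rk_inj).
have dis i : i \in E j -> i \notin Pc.
  by rewrite !inE => h; apply: contraTneq h => ->; rewrite rkc ltnn.
have cardE : #|E j.+1| = (#|E j| + #|S|.+1)%N.
  rewrite EE cardsU (_ : E j :&: Pc = set0) ?cards0 ?subn0.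
    by rewrite (cardsD1 c Pc) cP.
  by apply/setP => i; rewrite in_setI in_set0; apply/negbTE/negP => /andP[/dis/negP].
have ct : c != t by apply: contraTneq tj => <-; rewrite rkc ltnn.
have Sprop i : i \in S -> [/\ i != t, par i \in Pc & dep i = (dep (par i)).+1].
  rewrite !inE => /andP[ic /eqP ri].
  have iC : i \notin C by apply: contraNN ic => iC; rewrite -ri; have [-> _] := rootC iC.
  have [h1 h2] := rootN iC; split=> //; first exact: notC_neq.
  by rewrite -h1 ri.
have parE : par c \in E j.
  rewrite inE -rkc; have [_ h] := root_in (par c).
  exact: leq_ltn_trans h (rk_par ct).
set U := ~: (f @: E j) in fpot.
have cardU : #|U| = (#|V| - #|E j|)%N by rewrite cardsCs setCK card_in_imset.
have EV : (#|E j| + #|S|.+1 <= #|T|)%N by rewrite -cardE max_card.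
have TV : (#|T| <= #|V|)%N.
  rewrite -(ler_nat R); apply: le_trans room; rewrite lerDr; exact: ltW.
have UN : (#|U|%:R : R) = #|V|%:R - #|E j|%:R.
  by rewrite cardU natrB // (leq_trans _ TV) // (leq_trans (leq_addr _ _) EV).
have pot0 : 0 <= potential d Lam [set~ v].
  by apply: sumr_ge0 => p _; apply: expR_ge0.
have Lnu : 0 <= Lam / nu by rewrite divr_ge0 // ltW.
have kap2 : 0 <= 2 * kap by rewrite mulr_ge0 // ltW.
(* The growth so far is at most the whole budget in [start]. *)
have dens : forall p, 2^-1 + g <= density R d U p.
  apply: density_ge_potential Lam_gt0 _; apply: le_trans start.
  apply: (le_trans fpot); rewrite ler_wpM2l // ler_expR ler_wpM2l // lerD //.
    by rewrite ler_nat subset_leq_card // subsetIl.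
  by rewrite ler_wpM2l // ler_nat max_card.
have room' : nu + #|S|%:R + 1 <= #|U|%:R.
  rewrite UN; move: EV room; rewrite -(ler_nat R) natrD -natr1.
  set x := #|T|%:R; set y := #|E j|%:R; set z := #|S|%:R; set w := #|V|%:R; lra.
have Ss : (#|S| <= s)%N.
  by apply: leq_trans (piece_le c); rewrite subset_leq_card // subsetDl.
have [||f2 [f2c f2U f2inj f2arc f2pot]] := @embed_piece_potential R T V d U
  g nu Lam kap b B s K L par sg rk dep (f (par c)) c S g_gt0 g_le nu_gt0 gnu
  (ltW Lam_gt0) kap_gt0 kap_le1 B_ge b_ge1 b_le bK_le Lam_s dens room' cS Ss.
- move=> i iS; have [it pP di] := Sprop i iS.
  by split; [rewrite cSE | apply: rk_par | | apply: dep_le].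
- exact: dc.
rewrite cSE in f2U f2inj f2pot.
pose f' i := if i \in Pc then f2 i else f i.
have f'P i : i \in Pc -> f' i = f2 i by rewrite /f' => ->.
have f'E i : i \in E j -> f' i = f i by move=> /dis/negbTE h; rewrite /f' h.
have fU i k : i \in E j -> k \in Pc -> f i != f2 k.
  move=> iE kP; apply: contraTneq (f2U _ kP) => <-.
  by rewrite inE negbK imset_f.
exists f'; split.
- rewrite f'E // inE; have [-> _] := rootC tC => //.
- move=> i k; rewrite EE !in_setU => /orP[iE|iP] /orP[kE|kP].
  + by rewrite !f'E //; apply: finj.
  + by rewrite f'E // f'P // => /eqP; rewrite (negbTE (fU _ _ iE kP)).
  + by rewrite f'P // f'E // => /esym/eqP; rewrite (negbTE (fU _ _ kE iP)).
  + by rewrite !f'P //; apply: f2inj.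
- move=> i; rewrite EE in_setU => /orP[iE|iP] it.
    have pE : par i \in E j.
      move: iE; rewrite !inE; case: (boolP (i \in C)) => iC.
        have [-> _] := rootC iC; have [_ h] := root_in (par i).
        by move=> ij; apply: leq_ltn_trans h (ltn_trans (rk_par it) ij).
      by have [<- _] := rootN iC.
    by rewrite !f'E //; apply: farc.
  case: (eqVneq i c) => [->|ic]; first by rewrite (f'P c cP) (f'E _ parE).
  have iS : i \in S by rewrite in_setD1 ic.
  have [_ pP _] := Sprop i iS.
  by rewrite !f'P //; apply: f2arc.
- have im : ~: (f' @: E j.+1) = U :\: f2 @: Pc.
    rewrite EE imsetU setCU setDE; congr (~: _ :&: ~: _); apply: eq_in_imset => i //.
      exact: f'E.
    exact: f'P.
  rewrite im; apply: (le_trans f2pot).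
  apply: (le_trans (ler_wpM2r (expR_ge0 _) fpot)).
  rewrite -[leLHS]mulrA -expRD ler_wpM2l // ler_expR -mulrDr ler_wpM2l //.
  have CE : (#|C :&: E j|.+1 <= #|C :&: E j.+1|)%N.
    have cE : c \notin C :&: E j by rewrite !inE rc rkc ltnn andbF.
    rewrite -add1n -[1%N]/(nat_of_bool true) -cE -cardsU1 subset_leq_card //.
    apply/subsetP => i; rewrite in_setU1 !in_setI EE in_setU.
    by case/predU1P=> [->|/andP[-> ->]//]; rewrite cC cP orbT.
  move: CE; rewrite -(ler_nat R) cardE natrD -!natr1.
  move: kap_gt0; set x := #|C :&: E j|%:R; set y := #|C :&: E j.+1|%:R.
  set z := #|E j|%:R; set w := #|S|%:R; nra.
Qed.

Lemma embed_tree : exists f : T -> V,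
  [/\ injective f, f t = v &
      forall i, i != t -> arc d (sg i) (f (par i)) (f i)].
Proof.
have all_n n : exists f, good (rk t + n.+1) f.
  elim: n => [|n [f fgood]]; first by rewrite addn1; exists (fun=> v).
  by rewrite addnS; apply: good_step fgood; rewrite -addSnnS leq_addr.
have [f [ft finj farc _]] := all_n (\max_i rk i)%N.
have inE i : i \in E (rk t + (\max_i rk i).+1).
  rewrite inE; have [_ /leq_ltn_trans->//] := root_in i.
  by rewrite ltn_addl // ltnS leq_bigmax.
by exists f; split=> [i k /finj->|//|i it]; rewrite ?farc.
Qed.

End EmbedTree.

(** * Numerical estimates and the choice of constants *)

Lemma min_semideg_le (V : finType) (d : rel V) (b : bool) (x : V) :
  (min_semideg d <= #|nb d b x|)%N.
Proof.
have le_min (s : seq V) : x \in s ->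
    (\big[minn/#|V|]_(y <- s) minn (indeg d y) (outdeg d y) <=
     minn (indeg d x) (outdeg d x))%N.
  elim: s => // y s IH; rewrite in_cons big_cons => /predU1P[->|/IH].
    exact: geq_minl.
  exact/leq_trans/geq_minr.
apply: leq_trans (le_min _ (mem_index_enum x)) _.
by case: b; [apply: geq_minr | apply: geq_minl].
Qed.

Lemma potential_start (R : realType) (V : finType) (d : rel V) (v : V)
    (a Lam : R) :
  let n : R := #|V|%:R in
  0 <= Lam -> 0 <= a -> 2 <= n ->
  (forall b x, (2^-1 + a) * n <= #|nb d b x|%:R) ->
  potential d Lam [set~ v] <= 2 * n * expR (- (Lam * (2^-1 + a - n^-1))).
Proof.
move=> n Lam0 a0 n2 deg.
have n0 : 0 < n by apply: lt_le_trans n2.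
have cU : (#|[set~ v]|%:R : R) = n - 1.
  by rewrite cardsC1 -subn1 natrB // -(ler_nat R) (le_trans _ n2) // ler1n.
have U0 : 0 < (#|[set~ v]|%:R : R) by rewrite cU subr_gt0 (lt_le_trans _ n2) // ltr1n.
have dens p : 2^-1 + a - n^-1 <= density R d [set~ v] p.
  rewrite /density ler_pdivlMr // cU.
  have h1 : (#|nb d p.1 p.2|%:R : R) - 1 <= #|nb d p.1 p.2 :&: [set~ v]|%:R.
    rewrite lerBlDr natr1 ler_nat -setDE (cardsD1 v (nb _ _ _)) -addn1 addnC.
    by rewrite leq_add2l leq_b1.
  apply: le_trans h1; have := deg p.1 p.2.
  have nn : n^-1 * n = 1 by rewrite mulVf // gt_eqF.
  have : 0 < n^-1 by rewrite invr_gt0.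
  have : n^-1 <= 2^-1 by rewrite lef_pV2 ?posrE.
  by rewrite -/n; nra.
apply: (@le_trans _ _ (\sum_(p : bool * V) expR (- (Lam * (2^-1 + a - n^-1))))).
  apply: ler_sum => p _; rewrite ler_expR lerN2 ler_wpM2l //.
by rewrite sumr_const card_prod card_bool -[leLHS]mulr_natl natrM.
Qed.

(** Bernoulli's inequality for [(1 - x) ^+ K], inverted. *)
Lemma expr_inv_le (R : realFieldType) (x z : R) (K : nat) :
  0 <= x -> K%:R * x <= z -> z < 1 -> x < 1 ->
  ((1 - x)^-1) ^+ K <= (1 - z)^-1.
Proof.
move=> x0 Kx z1 x1.
have bern : 1 - K%:R * x <= (1 - x) ^+ K.
  elim: K {Kx} => [|K IH]; first by rewrite mul0r subr0 expr0.
  have y0 : 0 <= 1 - x by rewrite subr_ge0 ltW.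
  have p0 : 0 <= (1 - x) ^+ K by rewrite exprn_ge0.
  have p1 : (1 - x) ^+ K <= 1 by rewrite exprn_ile1 // gerBl.
  rewrite exprSr -natr1; nra.
rewrite exprVn lef_pV2 ?posrE ?exprn_gt0 ?subr_gt0 //.
by apply: le_trans bern; rewrite lerD2l lerN2.
Qed.

(** For [l] the logarithm of [n], squaring [1 + l / 2 <= expR (l / 2)] gives [l ^+ 2 / 4 <= n], so
    [n / l] is at least [l / 4]. *)
Lemma large_ln (R : realType) (X : R) : exists n0 : nat, forall n : nat,
  (n0 <= n)%N ->
  [/\ 0 < ln (n%:R : R), X <= ln n%:R, X <= n%:R & X <= n%:R / ln n%:R].
Proof.
pose Y := 1 + `|X|.
have Y1 : 1 <= Y by rewrite lerDl.
have XY : X <= Y by rewrite (le_trans (ler_norm X)) // lerDr.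
exists (Num.truncn (expR (4 * Y))).+1 => n hn.
have hx : expR (4 * Y) <= n%:R.
  apply: ltW; apply: lt_le_trans (truncnS_gt _) _; by rewrite ler_nat.
have n0 : 0 < (n%:R : R) by apply: lt_le_trans hx; apply: expR_gt0.
have ll : 4 * Y <= ln (n%:R : R).
  by rewrite -[leLHS](expRK) ler_ln ?posrE ?expR_gt0.
set l := ln _ in ll *.
have l0 : 0 < l by apply: lt_le_trans ll; rewrite mulr_gt0 // (lt_le_trans _ Y1).
have nE : (n%:R : R) = expR (l / 2) * expR (l / 2).
  by rewrite -expRD -splitr /l lnK.
have e2 : 1 + l / 2 <= expR (l / 2) by apply: expR_ge1Dx.
have nl : l * (l / 4) <= n%:R.
  rewrite nE; apply: (@le_trans _ _ ((1 + l / 2) * (1 + l / 2))); first by nra.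
  by apply: ler_pM => //; rewrite addr_ge0 // divr_ge0 // ltW.
have nl1 : l <= n%:R.
  apply: (@le_trans _ _ (1 + l)); first by rewrite lerDr.
  by rewrite -[leRHS](@lnK R) ?posrE // expR_ge1Dx.
split=> //; first by apply: le_trans ll; lra.
  by apply: le_trans nl1; lra.
rewrite ler_pdivlMr //; apply: le_trans nl; rewrite mulrC ler_pM2l //; lra.
Qed.

Theorem theorem2p2 (R : realType) (eps alpha : R) :
  0 < eps -> eps <= 1 -> 0 < alpha -> alpha <= 1 ->
  exists c0 : R, 0 < c0 /\
  forall c : R, 0 < c -> c <= c0 ->
  exists n0 : nat, forall n : nat, (n0 <= n)%N ->
  forall (V : finType) (d : rel V) (v : V),
    is_digraph d -> #|V| = n ->
    (2^-1 + alpha) * n%:R <= (min_semideg d)%:R ->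
  forall (T : finType) (r : rel T) (t : T),
    is_oriented_tree r ->
    #|T|%:R <= (1 - eps) * n%:R ->
    (max_underlying_deg r)%:R <= c * n%:R / ln n%:R ->
  exists f : T -> V, is_copy r d f /\ f t = v.
Proof.
move=> eps0 eps1 alpha0 alpha1.
(* Half of [alpha] is kept as density and half is spent. [K] and [L] make the share of the depth
   class and the restart error at most [kap / 4]; [s0] makes [Lam * s] at most [kap / 2 * nu]; [c0]
   keeps the children of heavy vertices below [kap / 4] of all vertices; [q / ln n] bounds
   [B * s]. *)
pose g := alpha / 2.
pose kap := alpha * eps / 24%:R.
pose s0 := kap * eps * alpha / 16%:R.
pose K := (Num.truncn (4 / kap)).+1.
pose L := Num.truncn (8%:R / kap).
pose q := 2 * L.+1%:R / (g * eps) * s0.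
pose c0 := kap * s0 / 8%:R.
have g0 : 0 < g by rewrite divr_gt0.
have g2 : g <= 2^-1 by rewrite /g; lra.
have ae0 : 0 < alpha * eps by rewrite mulr_gt0.
have ae1 : alpha * eps <= 1 by rewrite -[leRHS]mulr1 ler_pM // ltW.
have kap0 : 0 < kap by rewrite !(divr_gt0, ltr0n).
have kap1 : kap <= 24%:R^-1 by rewrite /kap; lra.
have s00 : 0 < s0 by rewrite !(mulr_gt0, invr_gt0, ltr0n).
have c00 : 0 < c0 by rewrite !(mulr_gt0, invr_gt0, ltr0n).
have [[ge0 epse0] [kape0 [s0e0 c0e0]]] :
    (0 <= g /\ 0 <= eps) /\ (0 <= kap /\ (0 <= s0 /\ 0 <= c0)) by do !split; apply: ltW.
have alphae0 : 0 <= alpha := ltW alpha0.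
have q0 : 0 <= q by rewrite /q !(mulr_ge0, invr_ge0, ler0n).
have Kkap : 4 <= K%:R * kap.
  rewrite -ler_pdivrMr //; apply/ltW/truncnS_gt.
have Lkap : 2 / L.+1%:R <= kap / 4.
  have : 8%:R <= L.+1%:R * kap by rewrite -ler_pdivrMr //; apply/ltW/truncnS_gt.
  have L0 : 0 < (L.+1%:R : R) by rewrite ltr0n.
  by move=> h; rewrite ler_pdivrMr //; move: h; lra.
exists c0; split=> // c cpos cc0.
(* The sum of all thresholds required below, so that one bound yields each of them. *)
pose X := 2 + (g * eps)^-1 + 4 * (K%:R * q) / kap + 8%:R / alpha
          + 8%:R * c0 / kap + 8%:R / kap + 4 / s0.
have [n0 hn0] := large_ln X.
exists n0 => n /hn0[l0 Xl Xn Xnl] V d v _ cV dmin T r t rtree Tle Dle.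
set l := ln n%:R in l0 Xl Xnl Dle.
set N : R := n%:R in Xn Xnl Dle Tle dmin *.
have X1 : 0 <= (g * eps)^-1 by rewrite invr_ge0 mulr_ge0 // ltW.
have X2 : 0 <= 4 * (K%:R * q) / kap by rewrite !(mulr_ge0, invr_ge0, ler0n) // ltW.
have X3 : 0 <= 8%:R / alpha by rewrite divr_ge0 ?ler0n // ltW.
have X4 : 0 <= 8%:R * c0 / kap by rewrite !(mulr_ge0, invr_ge0, ler0n) // ltW.
have X5 : 0 <= 8%:R / kap by rewrite divr_ge0 ?ler0n // ltW.
have X6 : 0 <= 4 / s0 by rewrite divr_ge0 ?ler0n // ltW.
have [n2 ngeps nK nalpha [nc0 nkap ns0]] : [/\ 2 <= N, 1 <= g * (eps * N),
    K%:R * q <= kap / 4 * l, 8%:R <= alpha * N &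
    [/\ 8%:R * c0 <= kap * l, 8%:R <= kap * N & 4 <= s0 * (N / l)]].
  rewrite /X in Xn Xl Xnl; split.
  - by move: X1 X2 X3 X4 X5 X6 Xn; clear; lra.
  - have ge0' : 0 < g * eps by rewrite mulr_gt0.
    by rewrite mulrA [leRHS]mulrC -ler_pdivrMr // div1r; move: X1 X2 X3 X4 X5 X6 Xn; clear; lra.
  - have : 4 * (K%:R * q) / kap <= l by move: X1 X2 X3 X4 X5 X6 Xl; clear; lra.
    rewrite ler_pdivrMr //; lra.
  - rewrite [leRHS]mulrC -ler_pdivrMr //; move: X1 X2 X3 X4 X5 X6 Xn; clear; lra.
  - split; rewrite [leRHS]mulrC -ler_pdivrMr //;
      move: X1 X2 X3 X4 X5 X6; [move: Xl | move: Xn | move: Xnl]; clear; lra.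
have N0 : 0 < N by apply: lt_le_trans n2.
have Nl0 : 0 < N / l by rewrite divr_gt0.
pose nu := eps * N.
have nu0 : 0 < nu by rewrite mulr_gt0.
(* Chosen so that [l] equals [Lam * (alpha / 8)]. *)
pose Lam := 8%:R / alpha * l.
have Lam0 : 0 < Lam by rewrite mulr_gt0 // !(divr_gt0, ltr0n).
pose s := Num.truncn (s0 * (N / l)).
have /andP[s1 s2] : s%:R <= s0 * (N / l) < s.+1%:R.
  by apply: truncn_itv; rewrite mulr_ge0 // ltW.
have s4 : (4 <= s)%N by rewrite truncn_ge_nat // mulr_ge0 // ltW.
have sp : (0 < s)%N by apply: leq_trans s4.
pose B := 2 * L.+1%:R / (g * nu).
have B0 : 0 <= B by rewrite !(mulr_ge0, invr_ge0, ler0n) // ltW.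
have Bs : B * s%:R <= q / l.
  apply: (le_trans (ler_wpM2l B0 s1)); rewrite le_eqVlt; apply/orP; left.
  apply/eqP; rewrite /B /q /nu; field.
  by rewrite !gt_eqF.
have KBs : K%:R * (B * s%:R) <= kap / 4.
  apply: (@le_trans _ _ (K%:R * (q / l))); first by rewrite ler_wpM2l.
  by rewrite mulrA ler_pdivrMr.
have Bs0 : 0 <= B * s%:R by rewrite mulr_ge0.
have Bs1 : B * s%:R < 1.
  apply: le_lt_trans (_ : kap / 4 < 1); last by clear - kap1; lra.
  by apply: le_trans KBs; rewrite ler_peMl // ler1n.
pose b := (1 - B * s%:R)^-1.
have b1 : 1 <= b by rewrite invf_ge1 ?subr_gt0 // gerBl.
(* The bound follows from [(1 + kap / 4) / (1 - kap / 4) <= 1 + kap]. *)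
have bK : b ^+ K * (1 + 2 / L.+1%:R) <= 1 + kap.
  have k41 : kap / 4 < 1 by clear - kap1; lra.
  have h := expr_inv_le Bs0 KBs k41 Bs1.
  have h0 : 0 <= 1 + 2 / L.+1%:R :> R by rewrite addr_ge0 // divr_ge0 ?ler0n.
  apply: (le_trans (ler_wpM2r h0 h)).
  rewrite mulrC ler_pdivrMr ?subr_gt0 //.
  apply: (le_trans (lerD (lexx 1) Lkap)).
  have : 0 <= kap * (2 - kap) by rewrite mulr_ge0 //; clear - kap1; lra.
  clear; lra.
have Lams : Lam * s%:R <= kap / 2 * nu.
  apply: (le_trans (ler_wpM2l (ltW Lam0) s1)); rewrite le_eqVlt; apply/orP; left.
  by apply/eqP; rewrite /Lam /s0 /nu; field; rewrite !gt_eqF.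
have [par [sg [rk [rkI rkpar kids hom]]]] := tree_rooting t rtree.
have [C [root [dep [[tC kidsC] rootC rootN [depK pieces] [qd [H [qdK HT Cle]]]]]]] :=
  tree_pieces rkpar kids sp (ltn0Sn _ : (0 < K)%N).
set Delta := max_underlying_deg r in kids Cle Dle.
have TN : #|T|%:R <= N.
  by apply: (le_trans Tle); rewrite ler_piMl ?gerBl // ltW.
have Dle0 : Delta%:R <= c0 * (N / l).
  apply: (le_trans Dle); rewrite -mulrA ler_wpM2r // ltW //.
(* The four contributions to [C] are at most [kap * N] times 1/8, 1/8, 1/4 and 1/4. *)
have CN : #|C|%:R <= kap * N.
  have hq : qd%:R <= kap * N / 4.
    have : qd%:R * K%:R <= N by apply: le_trans TN; rewrite -natrM ler_nat.
    move=> h; have : qd%:R * 4 <= qd%:R * (K%:R * kap) by rewrite ler_wpM2l.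
    have := ler_wpM2r (ltW kap0) h; rewrite -mulrA; clear; lra.
  have hD : Delta%:R <= kap * N / 8%:R.
    apply: (le_trans Dle0); rewrite mulrA ler_pdivrMr //.
    have := ler_wpM2l (ltW N0) nc0; clear; lra.
  have hH : H%:R * Delta%:R <= kap * N / 4.
    have hs : s0 * (N / l) / 2 <= s.-1%:R.
      have : (s.+1%:R : R) = s.-1%:R + 2.
        by rewrite -natrD addn2 prednK.
      by move: s2 ns0; clear; lra.
    have hHs : H%:R * s.-1%:R <= N by apply: le_trans TN; rewrite -natrM ler_nat.
    have h1 : H%:R * (s0 * (N / l) / 2) <= N.
      by apply: le_trans hHs; rewrite ler_wpM2l.
    have h2 : H%:R * Delta%:R <= H%:R * (c0 * (N / l)) by rewrite ler_wpM2l.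
    apply: (le_trans h2).
    have -> : H%:R * (c0 * (N / l)) = kap / 4 * (H%:R * (s0 * (N / l) / 2)).
      by rewrite /c0; field; rewrite gt_eqF.
    by rewrite [leRHS]mulrAC ler_wpM2l // divr_ge0.
  have : (#|C|%:R : R) <= 1 + Delta%:R + qd%:R + H%:R * Delta%:R.
    by rewrite -natrM nat1r -!natrD ler_nat.
  by move: hq hD hH nkap; clear; lra.
have room : nu + #|T|%:R <= #|V|%:R.
  by rewrite cV -/N /nu; move: Tle; clear; lra.
have deg b' x : (2^-1 + alpha) * N <= #|nb d b' x|%:R.
  by apply: (le_trans dmin); rewrite ler_nat min_semideg_le.
(* The slack [alpha - g] is four eighths of [alpha]: two absorb the factor [2 * N <= expR (l + l)],
   one the deletion of [v], and one the growth over all pieces. *)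
have start : potential d Lam [set~ v] *
    expR (Lam / nu * (#|C|%:R + 2 * kap * #|T|%:R)) <=
    expR (- (Lam * (2^-1 + g))).
  have := @potential_start R V d v alpha Lam (ltW Lam0) (ltW alpha0).
  rewrite cV -/N => /(_ n2 deg) hP.
  apply: (le_trans (ler_wpM2r (expR_ge0 _) hP)).
  have hN : 2 * N <= expR (l + l).
    by rewrite expRD /l lnK ?posrE // ler_wpM2r // ltW.
  have h2 : 2 * N * expR (- (Lam * (2^-1 + alpha - N^-1))) <=
      expR (l + l) * expR (- (Lam * (2^-1 + alpha - N^-1))).
    by rewrite ler_wpM2r ?expR_ge0.
  apply: (le_trans (ler_wpM2r (expR_ge0 _) h2)); rewrite -!expRD ler_expR.
  have hC : Lam / nu * (#|C|%:R + 2 * kap * #|T|%:R) <= Lam * (alpha / 8%:R).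
    apply: (@le_trans _ _ (Lam / nu * (3%:R * kap * N))).
      rewrite ler_wpM2l ?divr_ge0 // ?(ltW Lam0) ?(ltW nu0) //.
      have := ler_wpM2l (ltW kap0) TN; have := mulr_ge0 kape0 (ltW N0).
      by move: CN; clear; lra.
    rewrite le_eqVlt; apply/orP; left; apply/eqP.
    by rewrite /nu /kap; field; rewrite !gt_eqF.
  have hl : l = Lam * (alpha / 8%:R) by rewrite /Lam; field; rewrite gt_eqF.
  have hn : Lam * N^-1 <= Lam * (alpha / 8%:R).
    rewrite ler_pM2l // -[N^-1]mul1r ler_pdivrMr //; move: nalpha; clear; lra.
  rewrite /g; move: hC hl hn; clear; lra.
have kap1' : kap <= 1 by clear - kap1; lra.
have bi : b^-1 <= 1 - B * s%:R by rewrite invrK.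
have [f [finj ft farc]] := embed_tree sg rkI rkpar tC kidsC rootC rootN depK
  pieces g0 g2 nu0 ngeps Lam0 kap0 kap1' (lexx B) b1 bi bK Lams room start.
by exists f; do !split=> //; apply: hom.
Qed.
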